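(* Suppose the exact solution $c$ and the correction function $\mathcal C$ have the regularity specified in the context, and $\dot\gamma$, $\alpha$ and the data $f,g,q,c_0$ are uniformly bounded. Assume that either $\dot\gamma\ge 0$ on $[0,T]$ or $\dot\gamma\le 0$ on $[0,T]$. Initialize the scheme exactly on the interior nodes, $R^0\boldsymbol c^0=R^0\boldsymbol C^0$, and let the mesh parameters satisfy $$\frac12 h^2\le \tau<\frac{h}{\max_{[0,T]}|\dot\gamma(t)|}.$$ Then there exist a constant $h_0>0$ depending on $\gamma$, $v$ and $\alpha$, and a constant $C$ independent of $h$, $\tau$ and $n$, such that for all $h\le h_0$ the numerical solution satisfies $$\sup_{0\le n\le N_t}\left\|R^n(\boldsymbol C^n-\boldsymbol c^n)\right\|_\infty\le C e^{CT+\beta L}\,(\tau+h^2).$$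
   Context: **Continuous problem.** Let $L,T>0$, $\mathcal B=(0,L)$, and let $\gamma:[0,T]\to(0,L)$ be sufficiently regular (in particular continuously differentiable). Set $\Omega(t)=(0,\gamma(t))$, $Q_T=\bigcup_{t\in(0,T]}\Omega(t)\times\{t\}$, $\Sigma_T=\{(\gamma(t),t):t\in(0,T]\}$. Let $v\in\mathbb R$ be constant, $\alpha(t)=\dot\gamma(t)-v$, and let $\alpha_0\in\mathbb R$ satisfy $\alpha(t)\ge\alpha_0$ on $[0,T]$. The problem is $$\partial_t c+v\partial_x c=\partial_{xx}c+f \text{ in } Q_T,\quad \partial_x c+\alpha c=g\text{ on }\Sigma_T,\quad c=c_0\text{ in }\Omega(0)\times\{0\},\quad c=q\text{ on }\{0\}\times(0,T].$$ $C^{k,l}(U)$ is the space of functions $w$ with $\partial_t^j\partial_x^i w$ continuous in $U$ for $0\le i\le k$, $0\le j\le l$. It is assumed that $\gamma,c_0,f,g,q$ are such that $c\in C^{4,2}(\overline{Q_T})$. **Extended solution and correction function.** Extend $f$ by $0$ outside $Q_T$ and extend $c_0$ to $\mathcal B$. The exact solution is extended to $\mathcal B\times(0,T]$ as a solution of $\partial_t c+v\partial_x c=\partial_{xx}c+f$ off $\Sigma_T$, with $[\![c]\!]=0$ and $[\![\partial_x c]\!]=\psi$ on $\Sigma_T$, where $[\![w]\!]$ is the trace from $x<\gamma(t)$ minus the trace from $x>\gamma(t)$, with $c=q$ at $x=0$, $c=0$ at $x=L$, and with $\tfrac12\psi+\{\partial_x c+\alpha c\}=g$ on $\Sigma_T$,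 $\{\cdot\}$ being the average of the two traces. Let $\Omega_{\Gamma,T}=\{(x,t):0<t\le T,\ |x-\gamma(t)|<r_\Gamma\}\subset\mathcal B\times(0,T]$ for a fixed $r_\Gamma>0$. The correction function $\mathcal C:\Omega_{\Gamma,T}\to\mathbb R$ satisfies $\partial_t\mathcal C+v\partial_x\mathcal C=\partial_{xx}\mathcal C+F$ in $\Omega_{\Gamma,T}$, $\mathcal C=0$ and $\partial_x\mathcal C=\psi$ on $\Sigma_T$, $\mathcal C=0$ at $t=0$ for $|x-\gamma(0)|<r_\Gamma$, where $F$ is the smooth extension of $f|_{Q_T}$ to $\Omega_{\Gamma,T}$. Thus $\mathcal C=c^+-c^-$, where $c^+$ and $c^-$ are the smooth extensions to $\Omega_{\Gamma,T}$ of $c$ from $x<\gamma(t)$ and from $x>\gamma(t)$. Regularity: $c^+\in C^{4,2}(\overline{Q_T\cup\Omega_{\Gamma,T}})$ and $\mathcal C\in C^{4,2}(\overline{\Omega_{\Gamma,T}})$. **Grid.** $h=L/N$, $x_j=jh$, $\tau=T/N_t$, $t^n=n\tau$. $\gamma^n=\gamma(t^n)$, $\alpha^n=\alpha(t^n)$, $j(n)=\lfloor\gamma^n/h\rfloor$, $\sigma^n=\gamma^n/h-j(n)\in[0,1)$, $f_j^n=f(x_j,t^n)$, $g^n=g(t^n)$, $q^n=q(t^n)$. $\delta_{ij}$ is the Kronecker delta, $e_j$ the $j$-th standard basis vector of $\mathbb R^{N-1}$, and $R^n=[I\ \ 0]\in\mathbb R^{j(n)\times(N-1)}$ restricts to the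 first $j(n)$ entries. $\boldsymbol C^n=(c(x_1,t^n),\dots,c(x_{N-1},t^n))^T$. **Scheme.** Let $a_{n,1}=-\sigma^n(1+\tfrac12\alpha^n\sigma^n h)$, $b_{n,1}=-\tfrac12(\sigma^n)^2$, $a_{n,2}=(1-\sigma^n)(1-\tfrac12\alpha^n(1-\sigma^n)h)$, $b_{n,2}=-\tfrac12(1-\sigma^n)^2$. Let $A,B\in\mathbb R^{(N-1)\times(N-1)}$ be tridiagonal, $A$ with diagonal $2$ and off-diagonals $-1$, $B$ with diagonal $0$, superdiagonal $1$, subdiagonal $-1$. Set $$E^n=a_{n,2}(1-\tfrac{vh}{2})e_{j(n)}-a_{n,1}(1+\tfrac{vh}{2})e_{j(n)+1},$$ $$D^n=(\sigma^n-\tfrac12)e_{j(n)-1}+(-2\sigma^n+(1-\sigma^n)\alpha^nh)e_{j(n)}+(\sigma^n+\tfrac12+\sigma^n\alpha^nh)e_{j(n)+1},$$ $$Q^n=(\sigma^n+\tfrac12+\sigma^n\alpha^nh)a_{n,2},\qquad Z^{n-1}=\delta_{j(n-1),j(n)-1}a_{n-1,2}e_{j(n)}-\delta_{j(n-1),j(n)+1}a_{n-1,1}e_{j(n)+1},$$ $\rho=\frac1{h^2}+\frac v{2h}$, $\widetilde g^n=g^n-D^n_{j(n)+1}b_{n,2}hf(\gamma^n,t^n)$ (where $D^n_{j(n)+1}$ is the $(j(n)+1)$-th entry of $D^n$), and $$\widetilde f_j^n=f_j^n+\left(-(1+\tfrac{vh}2)\delta_{j,j(n)+1}b_{n,1}+(1-\tfrac{vh}2)\delta_{j,j(n)}b_{n,2}\right)f(\gamma^n,t^n)+\left(\delta_{j,j(n)}\delta_{j(n-1),j(n)-1}b_{n-1,2}-\delta_{j,j(n)+1}\delta_{j(n-1),j(n)+1}b_{n-1,1}\right)\tfrac{h^2}{\tau}f(\gamma^{n-1},t^{n-1}).$$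 The unknowns $\boldsymbol c^n\in\mathbb R^{N-1}$, $\psi^n\in\mathbb R$ satisfy for $n=1,\dots,N_t$ $$\left(I+\tfrac{\tau}{h^2}A+\tfrac{v\tau}{2h}B\right)\boldsymbol c^n-\tfrac{\tau}{h}E^n\psi^n=\boldsymbol c^{n-1}+hZ^{n-1}\psi^{n-1}+\tau\widetilde{\boldsymbol f}^n+\tau\rho q^ne_1,\qquad \tfrac1h(D^n)^T\boldsymbol c^n+Q^n\psi^n=\widetilde g^n,$$ and $\psi^0$ is determined from $\boldsymbol c^0$ by $\tfrac1h(D^0)^T\boldsymbol c^0+Q^0\psi^0=\widetilde g^0$. **Constants.** $\beta$ is a fixed number with $\beta>\max\{|\alpha_0|+1,|v|\}$. $C$ denotes a constant that may depend on bounds for the exact solution, $v$, $\alpha$, $\gamma$, the data, $T$ and $L$, but not on $h$, $\tau$, $n$. $\|\cdot\|_\infty$ is the maximum norm. *)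

(* Defs.v *)
From HB Require Import structures.
From mathcomp Require Import all_boot all_order all_algebra.
From mathcomp Require Import all_classical all_reals all_analysis.
Set Implicit Arguments.
Unset Strict Implicit.
Unset Printing Implicit Defensive.
Import Order.TTheory GRing.Theory Num.Theory.
Import numFieldNormedType.Exports.
Local Open Scope classical_set_scope.
Local Open Scope ring_scope.

(* Points of the plane are pairs p = (x, t), with p.1 = x and p.2 = t. *)

Section Regularity.
Variable R : realType.
Implicit Types (U : set (R * R)) (w F : R * R -> R).

(* [W i j] is the derivative d_t^j d_x^i w.  The derivatives are taken in the
   interior of U and are required to extend continuously to U; [W] is then
   determined on U when U is contained in the closure of its interior, as all
   the sets used below are.  This gives the usual meaning of C^{k,l} on the
   closure of an open set and on sets that contain the final time slice. *)
Definition is_jet (k l : nat) U w (W : nat -> nat -> R * R -> R) : Prop :=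
  [/\ forall p : R * R, U p -> W 0%N 0%N p = w p,
      forall i j, (i <= k)%N -> (j <= l)%N -> {within U, continuous (W i j)},
      forall i (p : R * R), (i < k)%N -> interior U p ->
        is_derive p.1 1 (fun x : R => W i 0%N (x, p.2)) (W i.+1 0%N p)
    & forall i j (p : R * R), (i <= k)%N -> (j < l)%N -> interior U p ->
        is_derive p.2 1 (fun t : R => W i j (p.1, t)) (W i j.+1 p)].

Definition Ckl (k l : nat) U w : Prop := exists W, is_jet k l U w W.

Definition Ckl_bounded (k l : nat) U w (M : R) : Prop :=
  exists2 W, is_jet k l U w W &
    forall i j (p : R * R), (i <= k)%N -> (j <= l)%N -> U p -> `|W i j p| <= M.

(* w_t + v w_x = w_xx + F in U *)
Definition solves_pde (v : R) U F w : Prop :=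
  exists2 W, is_jet 2 1 U w W &
    forall p : R * R, U p -> W 0%N 1%N p + v * W 1%N 0%N p = W 2%N 0%N p + F p.

End Regularity.

Section ContinuousProblem.
Variables (R : realType) (L T v r : R) (gamma dgamma : R -> R).

Record moving_interface : Prop := MovingInterface {
  mi_range : forall t : R, 0 <= t <= T -> 0 < gamma t < L;
  mi_cont : {within `[0, T], continuous gamma};
  mi_deriv : forall t : R, 0 < t < T -> is_derive t 1 gamma (dgamma t);
  mi_dcont : {within `[0, T], continuous dgamma}
}.

Definition alpha (t : R) : R := dgamma t - v.

Definition QT : set (R * R) :=
  [set p : R * R | 0 < p.2 <= T /\ 0 < p.1 < gamma p.2].

Definition SigmaT : set (R * R) :=
  [set p : R * R | 0 < p.2 <= T /\ p.1 = gamma p.2].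

Definition BT : set (R * R) := [set p : R * R | 0 < p.2 <= T /\ 0 < p.1 < L].

Definition OmegaGammaT : set (R * R) :=
  [set p : R * R | 0 < p.2 <= T /\ `|p.1 - gamma p.2| < r].

(* The data f is given on the closure of Q_T, so that its values on the
   interface are traces from x < gamma t; the zero extension keeps them. *)
Definition fext (f : R * R -> R) (p : R * R) : R :=
  if p.1 <= gamma p.2 then f p else 0.

Definition Dx (w : R * R -> R) (p : R * R) : R :=
  derive1 (fun x : R => w (x, p.2)) p.1.

(* one-sided limits at the interface from x < gamma t and from x > gamma t *)
Definition has_traces (w : R * R -> R) (t wl wr : R) : Prop :=
  w (x, t) @[x --> (gamma t)^'-] --> wl /\
  w (x, t) @[x --> (gamma t)^'+] --> wr.

Record exact_solution (f : R * R -> R) (g q c0 : R -> R) (c : R * R -> R)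
    : Prop := ExactSolution {
  es_fcont : {within closure QT, continuous f};
  es_gcont : {within `[0, T], continuous g};
  es_reg : Ckl 4 2 (closure QT) c;
  es_pde : solves_pde v QT f c;
  es_robin : forall t : R, 0 < t <= T -> exists cx : R,
    Dx c (x, t) @[x --> (gamma t)^'-] --> cx /\
    cx + alpha t * c (gamma t, t) = g t;
  es_init : forall x : R, 0 < x < gamma 0 -> c (x, 0) = c0 x;
  es_inflow : forall t : R, 0 < t <= T -> c (0, t) = q t
}.

(* Continuity is imposed up to x = 0, x = L and t = 0, but not at the corner
   (L, 0), where c0 and the boundary value need not be compatible. *)
Record extended_solution (f : R * R -> R) (g q c0 : R -> R) (c : R * R -> R)
    (psi : R -> R) : Prop := ExtendedSolution {
  xs_cont : {within [set p : R * R | (0 < p.2 <= T /\ 0 <= p.1 <= L) \/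
                             (p.2 = 0 /\ 0 < p.1 < L)], continuous c};
  xs_pde : solves_pde v (BT `\` SigmaT) (fext f) c;
  xs_interface : forall t : R, 0 < t <= T -> exists cl cr dl dr : R,
    [/\ has_traces c t cl cr,
        has_traces (Dx c) t dl dr,
        cl - cr = 0,
        dl - dr = psi t
      & 2^-1 * psi t + ((dl + alpha t * cl) + (dr + alpha t * cr)) / 2 = g t];
  xs_init : forall x : R, 0 < x < L -> c (x, 0) = c0 x;
  xs_left : forall t : R, 0 < t <= T -> c (0, t) = q t;
  xs_right : forall t : R, 0 < t <= T -> c (L, t) = 0
}.

(* [corr] is the correction function, [cp] and [cm] the smooth extensions of c
   from x < gamma t and from x > gamma t.  F need only be as smooth as the
   regularity of [corr] already forces it to be. *)
Record correction_function (f c F corr cp cm : R * R -> R) (psi : R -> R)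
    : Prop := CorrectionFunction {
  cf_F : forall p : R * R, QT p -> OmegaGammaT p -> F p = f p;
  cf_Freg : Ckl 2 1 OmegaGammaT F;
  cf_reg : Ckl 4 2 (closure OmegaGammaT) corr;
  cf_pde : solves_pde v OmegaGammaT F corr;
  cf_zero : forall t : R, 0 < t <= T -> corr (gamma t, t) = 0;
  cf_slope : forall t : R, 0 < t <= T ->
    is_derive (gamma t) 1 (fun x : R => corr (x, t)) (psi t);
  cf_init : forall x : R, `|x - gamma 0| < r -> corr (x, 0) = 0;
  cf_cpreg : Ckl 4 2 (closure (QT `|` OmegaGammaT)) cp;
  cf_cp : forall p : R * R, QT p -> cp p = c p;
  cf_cmreg : Ckl 4 2 OmegaGammaT cm;
  cf_cm : forall p : R * R, OmegaGammaT p -> gamma p.2 < p.1 -> cm p = c p;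
  cf_split : forall p : R * R, OmegaGammaT p -> corr p = cp p - cm p
}.

Record bounded_by (f : R * R -> R) (g q c0 : R -> R) (c corr cp : R * R -> R)
    (M : R) : Prop := BoundedBy {
  bb_dgamma : forall t : R, 0 <= t <= T -> `|dgamma t| <= M;
  bb_alpha : forall t : R, 0 <= t <= T -> `|alpha t| <= M;
  bb_f : forall p : R * R, closure QT p -> `|f p| <= M;
  bb_g : forall t : R, 0 <= t <= T -> `|g t| <= M;
  bb_q : forall t : R, 0 < t <= T -> `|q t| <= M;
  bb_c0 : forall x : R, 0 < x < L -> `|c0 x| <= M;
  bb_c : Ckl_bounded 4 2 (closure QT) c M;
  bb_corr : Ckl_bounded 4 2 (closure OmegaGammaT) corr M;
  bb_cp : Ckl_bounded 4 2 (closure (QT `|` OmegaGammaT)) cp M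
}.

End ContinuousProblem.

(* Spatial nodes are numbered by k : nat, x_k = k h; the i-th coordinate
   (i : 'I_(N - 1)) of a vector of R^(N-1) belongs to node k = i + 1. *)
Section Scheme.
Variables (R : realType) (L T v : R) (gamma dgamma : R -> R).
Variables (f : R * R -> R) (g q : R -> R) (N Nt : nat).

Definition hstep : R := L / N%:R.
Definition tstep : R := T / Nt%:R.
Local Notation h := hstep.
Local Notation tau := tstep.

Definition xnode (k : nat) : R := k%:R * h.
Definition tnode (n : nat) : R := n%:R * tau.

Definition gam (n : nat) : R := gamma (tnode n).
Definition alph (n : nat) : R := alpha v dgamma (tnode n).

(* floor of gamma^n / h, which is positive *)
Definition jn (n : nat) : nat := Num.truncn (gam n / h).
Definition sig (n : nat) : R := gam n / h - (jn n)%:R.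

Definition a1 (n : nat) : R := - sig n * (1 + 2^-1 * alph n * sig n * h).
Definition b1 (n : nat) : R := - 2^-1 * sig n ^+ 2.
Definition a2 (n : nat) : R :=
  (1 - sig n) * (1 - 2^-1 * alph n * (1 - sig n) * h).
Definition b2 (n : nat) : R := - 2^-1 * (1 - sig n) ^+ 2.

Definition kron (i j : nat) : R := (i == j)%:R.

(* a grid function k |-> w k restricted to the nodes 1, ..., N - 1 *)
Definition gridvec (w : nat -> R) : 'cV[R]_N.-1 := \col_i w i.+1.

Definition Amx : 'M[R]_N.-1 :=
  \matrix_(i, j) (2 * kron i j - kron i.+1 j - kron i j.+1).
Definition Bmx : 'M[R]_N.-1 := \matrix_(i, j) (kron i.+1 j - kron i j.+1).

Definition Eco (n k : nat) : R :=
  a2 n * (1 - v * h / 2) * kron k (jn n)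
  - a1 n * (1 + v * h / 2) * kron k (jn n).+1.

Definition Dco (n k : nat) : R :=
  (sig n - 2^-1) * kron k.+1 (jn n)
  + (- 2 * sig n + (1 - sig n) * alph n * h) * kron k (jn n)
  + (sig n + 2^-1 + sig n * alph n * h) * kron k (jn n).+1.

Definition Qco (n : nat) : R := (sig n + 2^-1 + sig n * alph n * h) * a2 n.

(* Z^{n-1} and \tilde f^n, with n = m + 1 *)
Definition Zco (m k : nat) : R :=
  kron (jn m).+1 (jn m.+1) * a2 m * kron k (jn m.+1)
  - kron (jn m) (jn m.+1).+1 * a1 m * kron k (jn m.+1).+1.

Definition fint (n : nat) : R := f (gam n, tnode n).

Definition ftilde (m k : nat) : R :=
  fext gamma f (xnode k, tnode m.+1)
  + (- (1 + v * h / 2) * kron k (jn m.+1).+1 * b1 m.+1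
     + (1 - v * h / 2) * kron k (jn m.+1) * b2 m.+1) * fint m.+1
  + (kron k (jn m.+1) * kron (jn m).+1 (jn m.+1) * b2 m
     - kron k (jn m.+1).+1 * kron (jn m) (jn m.+1).+1 * b1 m)
    * (h ^+ 2 / tau) * fint m.

Definition gtilde (n : nat) : R :=
  g (tnode n) - Dco n (jn n).+1 * b2 n * h * fint n.

Definition rho : R := 1 / h ^+ 2 + v / (2 * h).

Record numerical_solution (cn : nat -> 'cV[R]_N.-1) (psin : nat -> R)
    : Prop := NumericalSolution {
  ns_step : forall m, (m < Nt)%N ->
    (1%:M + (tau / h ^+ 2) *: Amx + (v * tau / (2 * h)) *: Bmx) *m cn m.+1
      - (tau / h * psin m.+1) *: gridvec (Eco m.+1)
    = cn m + (h * psin m) *: gridvec (Zco m) + tau *: gridvec (ftilde m)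
      + (tau * rho * q (tnode m.+1)) *: gridvec (kron 1);
  (* the case n = 0 is the equation that determines psi^0 *)
  ns_flux : forall n, (n <= Nt)%N ->
    h^-1 * ((gridvec (Dco n))^T *m cn n) 0 0 + Qco n * psin n = gtilde n
}.

Definition Rmx (n : nat) : 'M[R]_(jn n, N.-1) := pid_mx (jn n).

Definition Cvec (c : R * R -> R) (n : nat) : 'cV[R]_N.-1 :=
  gridvec (fun k => c (xnode k, tnode n)).

End Scheme.

(* Main.v *)
Require Import Defs.
From mathcomp Require Import all_boot all_order all_algebra.
From mathcomp Require Import all_classical all_reals all_analysis.
From mathcomp Require Import zify ring lra.
Set Implicit Arguments.
Unset Strict Implicit.
Unset Printing Implicit Defensive.
Import Order.TTheory GRing.Theory Num.Theory.
Import numFieldNormedType.Exports.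
Local Open Scope classical_set_scope.
Local Open Scope ring_scope.

(** The grid values to the left of the interface form a closed system.  Put
    [c_(j+1) + h a2 psi + h^2 b2 f(gamma)] in the place of the value at the
    first node beyond the interface: this ghost value approximates the smooth
    extension [cp] there, the equations at the nodes [k <= j] become the plain
    implicit scheme, the flux condition becomes a Robin condition for the
    interpolant of the three values nearest to the interface ([left_node],
    [left_robin]), and when the interface passes a node the old value required
    there is exactly the old ghost value.  So the error
    [e^n_k = cp (x_k, t^n) - u^n_k] satisfies the same equations, with
    truncation errors as right-hand sides.

    Consistency.  Taylor expansion of [cp] gives [O(tau + h^2)] at the nodes
    ([node_truncation]) and [O(h^2)] for the Robin condition
    ([robin_truncation]).  The differential equation and the boundary condition
    hold for the derivatives of [cp] on the closed left region, because they
    hold in its interior and all functions involved are continuous up to the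
    boundary ([jet_pde], [jet_robin]).

    Stability.  In the Robin condition the value at node [j - 1] has the
    coefficient [s - 1/2], where [s h] is the distance from node [j] to the
    interface; this has the wrong sign for [s > 1/2], but after the ghost value is eliminated the last row has
    the signs of an M-matrix whatever [tau] is.  Hence a discrete comparison
    principle holds as soon as one positive supersolution [phi] is known
    ([comparison]), and [|e^n_k| <= delta G^n phi_k] follows by induction on
    [n] ([stability]), where [delta = O(tau + h^2)].  The bound on the ghost
    value itself is needed because a moving interface turns ghost values into
    nodal values; for it the equation at node [j] is used again, and this is
    where [h^2 / 2 <= tau] enters ([ghost_comparison]).

    Barriers.  If the interface moves, [tau < h / max |gamma'|] makes [tau]
    small with [h]; then [(1 + b h)^k] with large [b] is a supersolution up to
    growth [G = 1 + 2 K tau], which costs only a factor [exp (2 K T)]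
    ([expbar_barrier]).  If the interface is at rest, [tau] may be of order one
    and no growth can be afforded; but then [alpha = - v], the boundary
    condition prescribes the diffusive minus convective flux, and a steady
    supersolution is found by integrating a decreasing positive flux
    ([fluxbar_barrier]). *)


(** * The discrete comparison principle *)

Section Comparison.
Variable R : realType.
Implicit Types (lam vh s ah : R) (z phi : nat -> R) (j k : nat).

(** Row [k] of [I + tau/h^2 A + v tau/(2h) B], with [lam = tau/h^2] and [vh = v h]. *)
Definition nodeop lam vh z k : R :=
  (1 + 2 * lam) * z k - lam * (1 + vh / 2) * z k.-1 - lam * (1 - vh / 2) * z k.+1.

(** [h] times the Robin expression at the point [x_j + s h]: the derivative of the
    quadratic interpolant through the nodes [j-1], [j], [j+1], plus [ah / h] times the
    value of the linear interpolant through [j] and [j+1]. *)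
Definition robinop s ah z j : R :=
  (s - 2^-1) * z j.-1 + (- 2 * s + (1 - s) * ah) * z j
  + (s + 2^-1 + s * ah) * z j.+1.

Lemma nodeopD lam vh z1 z2 k (a : R) :
  nodeop lam vh (fun i => a * z1 i + z2 i) k
  = a * nodeop lam vh z1 k + nodeop lam vh z2 k.
Proof. by rewrite /nodeop; ring. Qed.

Lemma robinopD s ah z1 z2 k (a : R) :
  robinop s ah (fun i => a * z1 i + z2 i) k
  = a * robinop s ah z1 k + robinop s ah z2 k.
Proof. by rewrite /robinop; ring. Qed.

(** Were [z] negative somewhere, subtracting the right multiple of [phi] would give a
    nonnegative [y] that vanishes at a node [i0] and satisfies [nodeop y > 0].  At an inner
    node this contradicts the signs of the neighbours' coefficients; at the last node the
    Robin condition bounds the ghost value from below by a multiple of its left neighbour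
    that is too small to compensate for that neighbour. *)
Lemma comparison lam vh s ah phi z j :
    0 < lam -> `|vh| <= 4^-1 -> `|ah| <= 4^-1 -> 0 <= s < 1 ->
    (forall k, (k <= j)%N -> 0 < phi k) ->
    (forall k, (0 < k <= j)%N -> 0 < nodeop lam vh phi k) ->
    0 <= robinop s ah phi j ->
    (forall k, (0 < k <= j)%N -> 0 <= nodeop lam vh z k) ->
    0 <= robinop s ah z j -> 0 <= z 0%N ->
  forall k, (k <= j)%N -> 0 <= z k.
Proof.
move=> lam0; rewrite !ler_norml => /andP[v1 v2] /andP[a1 a2] /andP[s0 s1].
move=> phi0 Lphi Bphi Lz Bz z0.
(* The node where z / phi is least. *)
pose i0 := [arg min_(i < (ord0 : 'I_j.+1)) (z i / phi i)%O]%O.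
have imin : forall k, (k <= j)%N -> z i0 / phi i0 <= z k / phi k.
  move=> k kj; rewrite /i0; case: arg_minP => // i _ /(_ (inord k) isT).
  by rewrite inordK.
have i0j : (i0 <= j)%N by rewrite -ltnS ltn_ord.
have [t0|t0] := leP 0 (z i0 / phi i0).
  move=> k kj; have := le_trans t0 (imin k kj).
  by rewrite pmulr_lge0 // invr_gt0 phi0.
exfalso; set t := _ / _ in t0 imin.
pose y k := (- t) * phi k + z k.
have y_ge0 k : (k <= j)%N -> 0 <= y k.
  by move=> kj; have := imin k kj; rewrite ler_pdivlMr ?phi0// /y; lra.
have yi0 : y i0 = 0.
  by rewrite /y /t mulNr divfK ?addNr// gt_eqF// phi0.
have Ly : forall k, (0 < k <= j)%N -> 0 < nodeop lam vh y k.
  move=> k kj; rewrite nodeopD ltr_wpDr ?Lz// mulr_gt0 ?Lphi// oppr_gt0 //.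
have By : 0 <= robinop s ah y j.
  by rewrite robinopD addr_ge0// mulr_ge0// oppr_ge0 ltW.
have i0_gt0 : (0 < i0)%N.
  rewrite lt0n; apply/negP => /eqP i00; move: yi0; rewrite /y i00.
  have := phi0 0%N isT; nra.
have := Ly _ (introT andP (conj i0_gt0 i0j)); rewrite /nodeop yi0 mulr0.
have y1 : 0 <= y i0.-1 by apply: y_ge0; rewrite (leq_trans (leq_pred _)).
have [ij|ij] := ltnP i0 j.
  have y2 := y_ge0 _ ij.
  have A0 := mulr_ge0 (ltW lam0) y1; have B0 := mulr_ge0 (ltW lam0) y2.
  nra.
have ej : nat_of_ord i0 = j by apply/eqP; rewrite eqn_leq i0j ij.
rewrite ej in y1 yi0 *; move: By; rewrite /robinop yi0 mulr0 addr0.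
set Y1 := y j.-1 in y1 *; set Y2 := y j.+1 => By.
have c1 : 0 < s + 2^-1 + s * ah by nra.
have -> : 0 - lam * (1 + vh / 2) * Y1 - lam * (1 - vh / 2) * Y2
  = - (lam * ((1 + vh / 2) * Y1 + (1 - vh / 2) * Y2)) by ring.
rewrite oppr_gt0 pmulr_rlt0//; apply/negP; rewrite -leNgt.
rewrite -(pmulr_lge0 _ c1).
have : (1 - vh / 2) * ((s - 2^-1) * Y1 + (s + 2^-1 + s * ah) * Y2) >= 0.
  by rewrite mulr_ge0//; lra.
have : 0 <= Y1 * ((1 + vh / 2) * (s + 2^-1 + s * ah) - (1 - vh / 2) * (s - 2^-1)).
  rewrite mulr_ge0//.
  by nra.
lra.
Qed.

(** For [s <= 1/2] the Robin condition alone has the right signs up to terms of order [h],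
    which the lower bound on [robinop] absorbs.  For [s > 1/2] the equation at node [j]
    bounds the left neighbour from above by the two other values; the coefficient of [z j]
    that results is nonnegative, up to order [h], exactly when [1/2 <= lam]. *)
Lemma ghost_comparison lam vh s ah z j :
    2^-1 <= lam -> `|vh| <= 4^-1 -> `|ah| <= 4^-1 -> 0 <= s < 1 ->
    0 <= nodeop lam vh z j -> (`|ah| + 2 * `|vh|) * z j <= robinop s ah z j ->
    0 <= z j.-1 -> 0 <= z j ->
  0 <= z j.+1.
Proof.
move=> lam2 vh4 ah4 /andP[s0 s1] Lz Bz z1 z2.
have lam0 : 0 < lam by lra.
move: (normr_ge0 vh) (normr_ge0 ah) (ler_norm ah) (ler_norm (- ah)).
move: (ler_norm vh) (ler_norm (- vh)); rewrite !normrN.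
move: Bz vh4 ah4; set V := `|vh|; set A := `|ah|; rewrite /robinop.
move: Lz; rewrite /nodeop.
set Z1 := z j.-1 in z1 *; set Z2 := z j in z2 *; set Z3 := z j.+1.
move=> Lz Bz V4 A4 vV vV' V0 A0 aA aA'.
have ahs : (1 - s) * ah <= A by nra.
have ahs' : - 4^-1 <= s * ah by nra.
have [s2|s2] := leP s 2^-1.
  have c1 : 0 < s + 2^-1 + s * ah by lra.
  rewrite -(pmulr_rge0 _ c1).
  nra.
have p0 : 0 < 1 + vh / 2 by lra.
have c1 : 0 < (s + 2^-1 + s * ah) * (1 + vh / 2) - (s - 2^-1) * (1 - vh / 2).
  by nra.
rewrite -(pmulr_rge0 _ c1).
(* The equation at node j, divided by lam: 1/lam + 2 <= 4. *)
have h1 : (s - 2^-1) * (1 + vh / 2) * Z1 <=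
  (s - 2^-1) * (4 * Z2 - (1 - vh / 2) * Z3).
  rewrite -mulrA ler_wpM2l//; first lra.
  rewrite -(ler_pM2l lam0).
  nra.
have := ler_wpM2l (ltW p0) Bz.
have : (A + 2 * V) * (1 + vh / 2) * Z2 >= ((1 - s) * ah * (1 + vh / 2)
    + 4 * (s - 2^-1) - 2 * s * (1 + vh / 2)) * Z2.
  rewrite ler_wpM2r//.
  nra.
nra.
Qed.

End Comparison.

(** * Stability from a barrier *)

Section Stability.
Variable R : realType.

(** Comparison applied to [A phi + w] and [A phi - w].  The flag [gh] says whether the
    bound is extended to the ghost node, which requires a surplus in the Robin inequality
    for [phi]. *)
Lemma barrier_step (lam vh s ah tau h delta K A0 A : R) (phi w : nat -> R) j
    (gh : bool) :
    0 < lam -> `|vh| <= 4^-1 -> `|ah| <= 4^-1 -> 0 <= s < 1 ->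
    0 < tau -> 0 < h -> 0 <= delta -> delta <= A -> A0 <= A * (1 - K * tau) ->
    0 < 1 - K * tau -> (gh -> 2^-1 <= lam) -> (0 < j)%N ->
    (forall k, (k <= j.+1)%N -> 0 < phi k) ->
    (forall k, (0 < k <= j)%N ->
       (1 - K * tau) * phi k + tau <= nodeop lam vh phi k) ->
    h + gh%:R * (2 * (`|ah| + 2 * `|vh|) * phi j) <= robinop s ah phi j ->
    (forall k, (0 < k <= j)%N -> `|nodeop lam vh w k| <= A0 * phi k + tau * delta) ->
    `|robinop s ah w j| <= h * delta -> w 0%N = 0 ->
  forall k, (k <= j + gh)%N -> `|w k| <= A * phi k.
Proof.
move=> lam0 vh4 ah4 s01 tau0 h0 delta0 deltaA A0A K1 ghlam j0 phi0 Lphi Bphi.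
move=> Lw Bw w0.
have A_ge0 : 0 <= A by lra.
have slack_ge0 : 0 <= gh%:R * (2 * (`|ah| + 2 * `|vh|) * phi j).
  by rewrite !mulr_ge0 ?addr_ge0 ?mulr_ge0// ltW// phi0.
pose z (b : bool) k := A * phi k + (-1) ^+ b * w k.
have Lz b k : (0 < k <= j)%N -> 0 <= nodeop lam vh (z b) k.
  move=> kj; rewrite nodeopD.
  have -> : nodeop lam vh (fun i => (-1) ^+ b * w i) k = (-1) ^+ b * nodeop lam vh w k.
    by rewrite /nodeop; ring.
  have := ler_wpM2l A_ge0 (Lphi _ kj); have := Lw _ kj.
  have pk : 0 < phi k by apply: phi0; case/andP: kj => _ /leqW.
  have tA : tau * delta <= tau * A by rewrite ler_wpM2l// ltW.
  have := ler_wpM2r (ltW pk) A0A.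
  case: b; rewrite ?expr1 ?expr0 ler_norml; move=> h1 /andP[h2 h3] h4; lra.
have Bz b : A * (gh%:R * (2 * (`|ah| + 2 * `|vh|) * phi j)) <= robinop s ah (z b) j.
  rewrite robinopD.
  have -> : robinop s ah (fun i => (-1) ^+ b * w i) j = (-1) ^+ b * robinop s ah w j.
    by rewrite /robinop; ring.
  have := ler_wpM2l A_ge0 Bphi.
  have tA : h * delta <= h * A by rewrite ler_wpM2l// ltW.
  move: Bw; case: b; rewrite ?expr1 ?expr0 ler_norml; move=> /andP[h2 h3] h4; lra.
have z_ge0 b k : (k <= j)%N -> 0 <= z b k.
  apply: (@comparison _ lam vh s ah phi (z b) j) => //.
  - by move=> i ij; apply/phi0/leqW.
  - move=> i ij; apply: lt_le_trans (Lphi _ ij).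
    by rewrite addr_gt0// mulr_gt0// phi0//; case/andP: ij => _ /leqW.
  - by apply: le_trans Bphi; rewrite addr_ge0// ltW.
  - exact: Lz.
  - by apply: le_trans (Bz b); rewrite mulr_ge0.
  - by rewrite /z w0 mulr0 addr0 mulr_ge0// ltW// phi0.
suff H b k : (k <= j + gh)%N -> 0 <= z b k.
  move=> k kj; rewrite ler_norml; apply/andP; split.
    by have := H false _ kj; rewrite /z expr0; lra.
  by have := H true _ kj; rewrite /z expr1; lra.
rewrite leq_eqVlt => /orP[/eqP ->|]; last first.
  by case: (gh) => /=; rewrite ?addn0 ?addn1 => kj; apply: z_ge0 => //; apply: ltnW.
case: gh ghlam Bphi slack_ge0 Bz => [ghlam|_] Bphi slack_ge0 Bz; last first.
  by rewrite addn0 z_ge0.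
rewrite addn1; apply: (@ghost_comparison _ lam vh s ah) => //.
- exact: ghlam.
- by apply: Lz; rewrite j0 leqnn.
- apply: le_trans (Bz b); rewrite [in leRHS]mul1r.
  have -> : A * (2 * (`|ah| + 2 * `|vh|) * phi j) =
    (`|ah| + 2 * `|vh|) * (2 * A * phi j) by ring.
  rewrite ler_wpM2l ?addr_ge0 ?mulr_ge0//.
  have := z_ge0 (~~ b) _ (leqnn j); rewrite /z.
  case: b {Lz Bz}; rewrite /= ?expr0 ?expr1; lra.
- by apply: z_ge0; rewrite (leq_trans (leq_pred _)).
- exact: z_ge0.
Qed.

(** The flag [gh] allows the interface to gain one node per step: the node gained was the
    ghost node one step earlier, so in that case the induction carries the ghost value
    along. *)
Lemma stability (h tau v K delta : R) (Nt : nat) (gh : bool) (j : nat -> nat)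
    (s al : nat -> R) (phi : nat -> R) (e : nat -> nat -> R) :
    0 < h -> 0 < tau -> 0 <= K -> K * tau <= 2^-1 -> 0 <= delta ->
    `|v * h| <= 4^-1 ->
    (gh -> 2^-1 * h ^+ 2 <= tau) ->
    (forall n, (n <= Nt)%N -> [/\ `|al n * h| <= 4^-1, 0 <= s n < 1 & (1 < j n)%N]) ->
    (forall m, (m < Nt)%N -> (j m.+1 <= j m + gh)%N) ->
    (forall n k, (n <= Nt)%N -> (k <= (j n).+1)%N -> 0 < phi k) ->
    (gh -> 4 * h <= phi (j 0%N).+1) ->
    (forall n k, (n <= Nt)%N -> (0 < k <= j n)%N ->
       (1 - K * tau) * phi k + tau <= nodeop (tau / h ^+ 2) (v * h) phi k) ->
    (forall n, (n <= Nt)%N ->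
       h + gh%:R * (2 * (`|al n * h| + 2 * `|v * h|) * phi (j n))
         <= robinop (s n) (al n * h) phi (j n)) ->
    (forall m k, (m < Nt)%N -> (0 < k <= j m.+1)%N ->
       `|nodeop (tau / h ^+ 2) (v * h) (e m.+1) k - e m k| <= tau * delta) ->
    (forall n, (n <= Nt)%N -> `|robinop (s n) (al n * h) (e n) (j n)| <= h * delta) ->
    (forall m, (m < Nt)%N -> e m.+1 0%N = 0) ->
    (forall k, (0 < k <= j 0%N)%N -> e 0%N k = 0) ->
  forall n k, (n <= Nt)%N -> (0 < k <= j n)%N ->
    `|e n k| <= delta * (1 + 2 * K * tau) ^+ n * phi k.
Proof.
move=> h0 tau0 K0 Ktau delta0 vh4 ghtau cond jj phi0 phi_gh Lphi Bphi Le Be e0 ei.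
suff H n : (n <= Nt)%N -> forall k, (0 < k <= j n + gh)%N ->
    `|e n k| <= delta * (1 + 2 * K * tau) ^+ n * phi k.
  move=> n k nN /andP[k0 kj]; apply: H => //.
  by rewrite k0 (leq_trans kj) ?leq_addr.
have Kt0 : 0 <= K * tau by rewrite mulr_ge0// ltW.
elim: n => [_ k /andP[k0]|n IH nN k /andP[k0 kj]].
  rewrite expr0 mulr1 leq_eqVlt => /orP[/eqP kE|]; last first.
    move=> kj; have kj0 : (k <= j 0%N)%N.
      by move: kj; case: (gh); rewrite ?addn1 ?addn0 ?ltnS //; apply: ltnW.
    rewrite ei ?k0// normr0 mulr_ge0// ltW// (phi0 0%N)// leqW//.
  case: (boolP gh) => hgh; rewrite ?hgh ?(negbTE hgh) in kE.
    2: rewrite kE addn0 ei; last by rewrite leqnn -(addn0 (j 0%N)) -kE k0.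
    2: by rewrite normr0 mulr_ge0// ltW// (phi0 0%N)// leqW.
  rewrite kE addn1; have [a4 /andP[s0 s1] j1] := cond 0%N isT.
  have e1 : e 0%N (j 0%N).-1 = 0.
    by apply: ei; rewrite leq_pred andbT -ltnS prednK// ltnW.
  have e2 : e 0%N (j 0%N) = 0 by apply: ei; rewrite leqnn andbT ltnW.
  have := Be 0%N isT; rewrite /robinop e1 e2.
  rewrite !mulr0 !add0r normrM.
  move: (a4); rewrite ler_norml => /andP[a41 a42].
  have c4 : 4^-1 <= `|s 0%N + 2^-1 + s 0%N * (al 0%N * h)|.
    apply: le_trans (ler_norm _); nra.
  have := ler_wpM2r (normr_ge0 (e 0%N (j 0%N).+1)) c4.
  have := ler_wpM2l delta0 (phi_gh hgh).
  lra.
have [a4 s01 j1] := cond _ nN.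
apply: (@barrier_step (tau / h ^+ 2) (v * h) (s n.+1) (al n.+1 * h) tau h delta K
  (delta * (1 + 2 * K * tau) ^+ n) _ phi (e n.+1) (j n.+1) gh) => //.
- by rewrite divr_gt0// exprn_gt0.
- by rewrite ler_peMr// exprn_ege1//; lra.
- rewrite exprSr -!mulrA ler_wpM2l//.
  rewrite -[leLHS]mulr1 ler_wpM2l ?exprn_ge0//; first lra.
  nra.
- lra.
- by move=> /ghtau; rewrite ler_pdivlMr// exprn_gt0.
- exact: ltnW.
- by move=> i ij; apply: (phi0 n.+1).
- by move=> i ij; apply: (Lphi n.+1).
- exact: Bphi.
- move=> i ij; have := Le n i nN ij; have /andP[i0 i1] := ij.
  have := IH (ltnW nN) i; rewrite i0 (leq_trans i1) ?jj// => /(_ isT).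
  set x := nodeop _ _ _ _ => h1 h2.
  have := ler_normD (x - e n i) (e n i); rewrite subrK; lra.
- exact: Be.
- exact: e0.
Qed.

(** * An exponential barrier *)

Definition expbar (b h : R) (k : nat) : R := (1 + b * h) ^+ k.

(** The second difference of [(1 + b h)^k] is about [b^2 (1 + b h)^k], so the exponential is
    a supersolution only after growth in time at the rate [b^2 + 2 |v| b + 1] is allowed. *)
Lemma expbar_node (b h tau v : R) k : 0 < h -> 0 < tau -> 0 < b -> b * h <= 4^-1 ->
  (0 < k)%N ->
  (1 - (b ^+ 2 + 2 * `|v| * b + 1) * tau) * expbar b h k + tau
    <= nodeop (tau / h ^+ 2) (v * h) (expbar b h) k.
Proof.
move=> h0 tau0 b0 bh k0; set e := b * h.
have e0 : 0 < e by rewrite mulr_gt0.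
rewrite /nodeop /expbar -/e; case: k k0 => //= k _.
have e1 : 0 < 1 + e by lra.
have p0 : 0 < (1 + e) ^+ k by rewrite exprn_gt0.
have p1 : 1 <= (1 + e) ^+ k by rewrite exprn_ege1// lerDl ltW.
rewrite !(exprS (1 + e)); set p := (1 + e) ^+ k in p0 p1 *.
set lam := tau / h ^+ 2.
have lamh : tau = lam * h ^+ 2 by rewrite /lam divfK// gt_eqF// exprn_gt0.
have lam0 : 0 < lam by rewrite divr_gt0// exprn_gt0.
have -> : (1 + 2 * lam) * ((1 + e) * p) - lam * (1 + v * h / 2) * p -
  lam * (1 - v * h / 2) * ((1 + e) * ((1 + e) * p)) =
  p * (1 + e) + p * lam * (- e ^+ 2 + v * h * e * (1 + e / 2)).
  by field.
have h1 : p * lam * (- e ^+ 2 - `|v| * h * e * (2 * (1 + e))) <=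
   p * lam * (- e ^+ 2 + v * h * e * (1 + e / 2)).
  apply: ler_wpM2l; first by rewrite mulr_ge0// ltW.
  rewrite lerD2l.
  have h2 : - `|v| <= v by have := ler_norm (- v); rewrite normrN; lra.
  have h3 : 0 <= h * e * (1 + e / 2) by rewrite !mulr_ge0// ?ltW//; lra.
  have := ler_wpM2r h3 h2.
  have h4 : 0 <= `|v| * (h * e) * (3 / 2 * e + 1) by rewrite !mulr_ge0// ?ltW//; lra.
  lra.
apply: (le_trans _ (lerD (lexx (p * (1 + e))) h1)).
have e2 : e ^+ 2 * tau = e ^+ 2 * (lam * h ^+ 2) by rewrite lamh.
have t1 : tau <= tau * ((1 + e) * p).
  rewrite ler_peMr ?ltW//. nra.
have -> : p * lam * (- e ^+ 2 - `|v| * h * e * (2 * (1 + e))) =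
  - (b ^+ 2 * tau * p) - 2 * `|v| * b * tau * ((1 + e) * p).
  by rewrite lamh /e; ring.
have := mulr_ge0 (mulr_ge0 (sqr_ge0 b) (ltW tau0)) (mulr_ge0 (ltW e0) (ltW p0)).
nra.
Qed.

(** The discrete derivative of the exponential is about [b] times its value and dominates
    the zero-order terms, including the surplus that the ghost value requires. *)
Lemma expbar_robin (b h v s al a : R) j : 0 < h -> 0 < b -> b * h <= 4^-1 ->
  0 <= s < 1 -> `|al| <= a -> 6 * a + 8 * `|v| + 2 <= b -> (0 < j)%N ->
  h + 2 * (`|al * h| + 2 * `|v * h|) * expbar b h j
    <= robinop s (al * h) (expbar b h) j.
Proof.
move=> h0 b0 bh /andP[s0 s1] ala ab j0; set e := b * h.
have e0 : 0 < e by rewrite mulr_gt0.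
rewrite /robinop /expbar -/e; case: j j0 => //= j _.
have e1 : 0 < 1 + e by lra.
have p0 : 0 < (1 + e) ^+ j by rewrite exprn_gt0.
have p1 : 1 <= (1 + e) ^+ j by rewrite exprn_ege1// lerDl ltW.
rewrite !(exprS (1 + e)); set p := (1 + e) ^+ j in p0 p1 *.
rewrite !normrM (gtr0_norm h0).
have -> : (s - 2^-1) * p + (- 2 * s + (1 - s) * (al * h)) * ((1 + e) * p) +
    (s + 2^-1 + s * (al * h)) * ((1 + e) * ((1 + e) * p)) =
  p * (e + (s + 2^-1) * e ^+ 2 + al * h * (1 + e) * (1 + s * e)).
  by field.
have h1 : h <= p * h by rewrite ler_peMl// ltW.
apply: (@le_trans _ _ (p * (h + 2 * (`|al| * h + 2 * (`|v| * h)) * (1 + e)))).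
  by rewrite mulrDr; lra.
apply: ler_wpM2l; first exact: ltW.
have alN : - `|al| <= al by have := ler_norm (- al); rewrite normrN; lra.
have A0 := normr_ge0 al; have V0 := normr_ge0 v.
move: (e0) (bh); rewrite -/e => _ e4.
have g0 : 0 <= h * (1 + e) * (1 + s * e) by rewrite !mulr_ge0 ?ltW//; nra.
have := ler_wpM2r g0 alN.
have g1 : h * (1 + e) * (1 + s * e) <= h * (1 + e) * (5 / 4).
  by apply: ler_wpM2l; [rewrite mulr_ge0// ltW | nra].
have := ler_wpM2l A0 g1.
have g2 : h * (1 + e) <= h * (5 / 4) by apply: ler_wpM2l; [exact: ltW | lra].
have := ler_wpM2l A0 g2; have := ler_wpM2l V0 g2.
have := ler_wpM2r (ltW h0) ab; rewrite -/e.
have := ler_wpM2r (ltW h0) ala.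
have := mulr_ge0 s0 (sqr_ge0 e); have := sqr_ge0 e.
have := mulr_ge0 V0 (ltW h0).
have := mulr_ge0 A0 (ltW h0).
lra.
Qed.

Lemma expbar_le (b h L : R) k : 0 <= b -> 0 <= h -> k%:R * h <= L ->
  expbar b h k <= expR (b * L).
Proof.
move=> b0 h0 kL; apply: (@le_trans _ _ (expR (b * h) ^+ k)).
  by rewrite /expbar lerXn2r ?nnegrE ?expR_ge0 ?expR_ge1Dx// addr_ge0// mulr_ge0.
rewrite -expRM_natl ler_expR (_ : _ * _ = b * (k%:R * h)); last by ring.
by rewrite ler_wpM2l.
Qed.

End Stability.

(** * A steady barrier *)

Section Barriers.
Variable R : realType.

(** The values are determined by prescribing [2 + 2 L - k h] as the flux
    [(phi_(k+1) - phi_k) / h - v (phi_(k+1) + phi_k) / 2] between the nodes [k] and [k+1].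
    Since this flux decreases at unit rate, the steady equation holds with source [1]. *)
Fixpoint fluxbar (v L h : R) (k : nat) : R :=
  if k is i.+1 then
    ((1 + v * h / 2) * fluxbar v L h i + h * (2 + 2 * L - i%:R * h))
      / (1 - v * h / 2)
  else 1.

Section FluxBarrier.
Variables (v L h : R).
Hypotheses (L0 : 0 < L) (h0 : 0 < h) (vh4 : `|v * h| <= 4^-1).
Let vh4P : - 4^-1 <= v * h <= 4^-1. Proof. by rewrite -ler_norml. Qed.

Lemma fluxbarS k : (1 - v * h / 2) * fluxbar v L h k.+1
  = (1 + v * h / 2) * fluxbar v L h k + h * (2 + 2 * L - k%:R * h).
Proof.
have [L_gt0 h_gt0] := (L0, h0); case/andP: vh4P => h1 h2.
by rewrite /= mulrC divfK// gt_eqF//; lra.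
Qed.

Lemma fluxbar_gt0 k : k%:R * h <= L -> 0 < fluxbar v L h k.
Proof.
have [L_gt0 h_gt0] := (L0, h0); case/andP: vh4P => h1 h2; elim: k => // k IH kL.
have kL' : k%:R * h <= L by apply: le_trans kL; rewrite ler_pM2r// ler_nat.
have m0 : 0 < 1 - v * h / 2 by lra.
rewrite -(pmulr_rgt0 _ m0) fluxbarS; apply: addr_gt0; apply: mulr_gt0 => //;
  [lra | exact: IH | lra].
Qed.

(** A discrete Gronwall argument for [phi_k + 4 + 4 L], the shift absorbing the inhomogeneous
    term of the recursion. *)
Lemma fluxbar_le k : k%:R * h <= L ->
  fluxbar v L h k <= (5 + 4 * L) * expR ((2 * `|v| + 1) * L).
Proof.
have [L_gt0 h_gt0] := (L0, h0); case/andP: vh4P => h1 h2.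
have V0 := normr_ge0 v.
suff H : k%:R * h <= L ->
    fluxbar v L h k + (4 + 4 * L) <= (5 + 4 * L) * (1 + (2 * `|v| + 1) * h) ^+ k.
  move=> kL; have w0 : 0 <= 2 * `|v| + 1 by lra.
  have := @expbar_le R (2 * `|v| + 1) h L k w0 (ltW h0) kL; rewrite /expbar.
  have := H kL.
  set A := (1 + _) ^+ k; set E := expR _ => hA /(@ler_wpM2l _ (5 + 4 * L)).
  have : 0 <= 5 + 4 * L by lra.
  move=> /[swap] /[apply]; lra.
elim: k => [_|k IH kL]; first by rewrite expr0 /=; lra.
have kL' : k%:R * h <= L by apply: le_trans kL; rewrite ler_pM2r// ler_nat.
have phi0 := fluxbar_gt0 kL'.
have m0 : 0 < 1 - v * h / 2 by lra.
have kh0 : 0 <= k%:R * h by rewrite mulr_ge0// ltW.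
have Vh : v * h <= `|v| * h by rewrite ler_pM2r// ler_norm.
have Vh0 : 0 <= `|v| * h by rewrite mulr_ge0// ltW.
have step : fluxbar v L h k.+1 + (4 + 4 * L) <=
   (fluxbar v L h k + (4 + 4 * L)) * (1 + (2 * `|v| + 1) * h).
  have := fluxbarS k; set x := fluxbar _ _ _ k in phi0 *.
  set y := fluxbar _ _ _ _.
  have Vhx := ler_wpM2r (ltW phi0) Vh.
  have hx : 0 < h * x by rewrite mulr_gt0.
  have hL : 0 < h * L by rewrite mulr_gt0.
  have hk : 0 <= h * (k%:R * h) by rewrite mulr_ge0// ltW.
  have VhL : 0 <= (`|v| * h) * L by rewrite mulr_ge0// ltW.
  have Vhx0 : 0 <= (`|v| * h) * x by rewrite mulr_ge0// ltW.
  move=> E; rewrite -(ler_pM2l m0) mulrDr E.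
  have : h * (2 + 2 * L - k%:R * h) + v * h * x <=
    (1 - v * h / 2) * (2 * (`|v| * h * x + h * (2 + 2 * L))).
    nra.
  have : 0 <= (1 - v * h / 2) * (h * x + 2 * `|v| * h * (4 + 4 * L)).
    by apply: mulr_ge0; [exact: ltW | nra].
  nra.
apply: le_trans step _; rewrite exprSr mulrA ler_wpM2r ?IH//.
by rewrite addr_ge0// mulr_ge0 ?ltW//; lra.
Qed.

Lemma fluxbar_node (tau : R) k : (0 < k)%N ->
  nodeop (tau / h ^+ 2) (v * h) (fluxbar v L h) k = fluxbar v L h k + tau.
Proof.
case: k => // k _; set lam := tau / h ^+ 2.
have -> : tau = lam * h ^+ 2 by rewrite /lam divfK// expf_neq0// gt_eqF.
have := fluxbarS k.+1; have := fluxbarS k.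
rewrite /nodeop -pred_Sn -natr1; set x := fluxbar _ _ _ k.
set y := fluxbar _ _ _ k.+1; set z := fluxbar _ _ _ k.+2 => E1 E2.
have -> : (1 + 2 * lam) * y - lam * (1 + v * h / 2) * x
    - lam * (1 - v * h / 2) * z =
  y + lam * ((1 - v * h / 2) * y - (1 + v * h / 2) * x)
    - lam * ((1 - v * h / 2) * z - (1 + v * h / 2) * y) by field.
by rewrite E1 E2; ring.
Qed.

(** With [alpha = - v] the Robin expression is the prescribed flux extrapolated to the
    interface, up to a second difference of size [O(h)]. *)
Lemma fluxbar_robin (s : R) j : 0 <= s < 1 -> (0 < j)%N -> j.+1%:R * h <= L ->
  h * `|v| * (`|v| * ((5 + 4 * L) * expR ((2 * `|v| + 1) * L)) + 2 + 2 * L) <= 1 ->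
  h <= robinop s (- v * h) (fluxbar v L h) j.
Proof.
have [L_gt0 h_gt0] := (L0, h0); case/andP: vh4P => h1 h2 /andP[s0 s1]; case: j => // j _ jL.
set Phi := _ * expR _ => hPhi.
have jL1 : j.+1%:R * h <= L by apply: le_trans jL; rewrite ler_pM2r// ler_nat.
have jL2 : j%:R * h <= L by apply: le_trans jL1; rewrite ler_pM2r// ler_nat.
have V0 := normr_ge0 v.
have diff k : k.+1%:R * h <= L ->
   `|fluxbar v L h k.+1 - fluxbar v L h k| <= 2 * h * (`|v| * Phi + 2 + 2 * L).
  move=> kL; have kL' : k%:R * h <= L by apply: le_trans kL; rewrite ler_pM2r// ler_nat.
  have m0 : 0 < 1 - v * h / 2 by lra.
  have := fluxbarS k; have := fluxbar_gt0 kL'; have := fluxbar_le kL'; rewrite -/Phi.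
  set x := fluxbar _ _ _ k; set y := fluxbar _ _ _ _ => xPhi x0 E.
  have E2 : (1 - v * h / 2) * (y - x) = h * (v * x + (2 + 2 * L - k%:R * h)).
    by rewrite mulrBr E; field.
  have : `|(1 - v * h / 2) * (y - x)| <= h * (`|v| * Phi + (2 + 2 * L)).
    rewrite E2 normrM (gtr0_norm h0) ler_pM2l//.
    apply: le_trans (ler_normD _ _) _; apply: lerD.
      by rewrite normrM (gtr0_norm x0) ler_wpM2l.
    have kh0 : 0 <= k%:R * h by rewrite mulr_ge0// ltW.
    by rewrite ler_norml; apply/andP; split; lra.
  rewrite normrM (gtr0_norm m0) => A; have := normr_ge0 (y - x); nra.
have := diff _ jL1; have := diff _ jL.
have := fluxbarS j.+1; have := fluxbarS j.
rewrite /robinop -pred_Sn; set x := fluxbar _ _ _ j; set y := fluxbar _ _ _ j.+1.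
set z := fluxbar _ _ _ j.+2; set G := _ + 2 + _ => E1 E2 d1 d2.
have -> : (s - 2^-1) * x + (- 2 * s + (1 - s) * (- v * h)) * y +
    (s + 2^-1 + s * (- v * h)) * z =
  (s + 2^-1) * ((1 - v * h / 2) * z - (1 + v * h / 2) * y) -
  (s - 2^-1) * ((1 - v * h / 2) * y - (1 + v * h / 2) * x)
  - ((v * h) * (s - 2^-1) / 2 * ((z - y) - (y - x))).
  by field.
rewrite E1 E2.
have : `|(v * h) * (s - 2^-1) / 2 * ((z - y) - (y - x))| <=
   (`|v| * h) * 2^-1 / 2 * (2 * h * G + 2 * h * G).
  rewrite !normrM; apply: ler_pM; [by rewrite !mulr_ge0 | by [] | |].
    rewrite (gtr0_norm h0) [`|2^-1|]ger0_norm//.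
    apply: ler_wpM2r => //; apply: ler_wpM2l; first by rewrite mulr_ge0// ltW.
    by rewrite ler_norml; apply/andP; split; lra.
  by apply: le_trans (ler_normB _ _) _; apply: lerD.
rewrite ler_norml => /andP[_].
have : h * (h * `|v| * G) <= h * 1 by rewrite ler_pM2l.
have n1 : j.+1%:R = j%:R + 1 :> R by rewrite natr1.
have n2 : j.+2%:R = j%:R + 1 + 1 :> R by rewrite !natr1.
rewrite n1; move: jL; rewrite n2 => jL.
have : 0 <= h * (L - (j%:R + 1 + 1) * h) by apply: mulr_ge0; [exact: ltW | rewrite subr_ge0].
have : 0 <= h * ((1 - s) * h) by apply: mulr_ge0; [|apply: mulr_ge0]; lra.
have : 0 < h * L by rewrite mulr_gt0.
have := mulr_gt0 h0 h0.
set X := v * h * _ / 2 * _.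
have -> : (s + 2^-1) * ((1 + v * h / 2) * y + h * (2 + 2 * L - (j%:R + 1) * h) -
   (1 + v * h / 2) * y) - (s - 2^-1) * ((1 + v * h / 2) * x +
   h * (2 + 2 * L - j%:R * h) - (1 + v * h / 2) * x) =
   h * (2 + 2 * L - j%:R * h) - (s + 2^-1) * h * h by field.
lra.
Qed.

End FluxBarrier.
End Barriers.

(** * The scheme to the left of the interface *)

Section LeftScheme.
Variables (R : realType) (L T v : R) (gamma dgamma : R -> R).
Variables (f : R * R -> R) (g q : R -> R) (N Nt : nat).
Variables (cn : nat -> 'cV[R]_N.-1) (psin : nat -> R).
Local Notation h := (hstep L N).
Local Notation tau := (tstep T Nt).
Local Notation jn := (jn L T gamma N Nt).
Local Notation gam := (gam T gamma Nt).
Local Notation sig := (sig L T gamma N Nt).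
Local Notation alph := (alph T v dgamma Nt).
Local Notation tnode := (tnode T Nt).
Local Notation xnode := (xnode L N).

(** Written as a sum so that the value is [0] for node numbers outside [1 .. N - 1]. *)
Definition nodal (c : 'cV[R]_N.-1) (k : nat) : R := \sum_(l < N.-1) kron R k l.+1 * c l 0.

Lemma nodal0 c : nodal c 0 = 0.
Proof. by rewrite /nodal big1// => l _; rewrite /kron mul0r. Qed.

Lemma nodalE c (i : 'I_N.-1) : nodal c i.+1 = c i 0.
Proof.
rewrite /nodal (bigD1 i)//= /kron eqxx mul1r big1 ?addr0// => l li.
by rewrite eqSS eq_sym (inj_eq val_inj) (negbTE li) mul0r.
Qed.

(** The inflow value at node [0], the unknowns at the nodes [1 .. j], and at node [j + 1]
    the ghost value, which extends the solution from the left across the jump. *)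
Definition leftval (n k : nat) : R :=
  nodal (cn n) k + kron R k 0 * q (tnode n)
  + kron R k (jn n).+1 * (h * a2 L T v gamma dgamma N Nt n * psin n
      + h ^+ 2 * b2 L T gamma N Nt n * fint T gamma f Nt n).

Hypotheses (h0 : 0 < h) (tau0 : 0 < tau).
Hypothesis num : numerical_solution L T v gamma dgamma f g q Nt cn psin.

Lemma kronS i j : kron R i.+1 j.+1 = kron R i j.
Proof. by []. Qed.

Lemma kron_neq i j : i != j -> kron R i j = 0.
Proof. by rewrite /kron => /negbTE ->. Qed.

Lemma kronii i : kron R i i = 1.
Proof. by rewrite /kron eqxx. Qed.

Lemma left_robin n : (n <= Nt)%N -> (1 < jn n)%N ->
  robinop (sig n) (alph n * h) (leftval n) (jn n) = h * g (tnode n).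
Proof.
move=> nN j1; have := ns_flux num nN; set j := jn n in j1 *.
have -> : ((gridvec N (Dco L T v gamma dgamma N Nt n))^T *m cn n) 0 0 =
   (sig n - 2^-1) * nodal (cn n) j.-1
   + (- 2 * sig n + (1 - sig n) * alph n * h) * nodal (cn n) j
   + (sig n + 2^-1 + sig n * alph n * h) * nodal (cn n) j.+1.
  rewrite mxE /nodal !mulr_sumr -!big_split /=; apply: eq_bigr => l _.
  rewrite !mxE /Dco -/j /kron !mulrDl -!mulrA.
  have -> : (l.+2 == j) = (j.-1 == l.+1) by lia.
  by rewrite [l.+1 == j]eq_sym [l.+1 == j.+1]eq_sym.
rewrite /gtilde /Qco /Dco -/j /robinop /leftval -/j !kronii.
have k1 : kron R j.+2 j = 0 by apply: kron_neq; lia.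
have k2 : kron R j.+1 j = 0 by apply: kron_neq; lia.
have k3 : kron R j j.+1 = 0 by apply: kron_neq; lia.
have k4 : kron R j.-1 j.+1 = 0 by apply: kron_neq; lia.
have k5 : kron R j.-1 0 = 0 by apply: kron_neq; lia.
have k6 : kron R j 0 = 0 by apply: kron_neq; lia.
have k7 : kron R j.+1 0 = 0 by [].
rewrite k1 k2 k3 k4 k5 k6 k7 !mulr0 !mul0r !addr0 !add0r mulr1 mul1r => E.
apply: (mulfI (invr_neq0 (lt0r_neq0 h0))); rewrite mulKf ?gt_eqF//.
rewrite -[RHS](subrK ((sig n + 2^-1 + sig n * alph n * h)
  * b2 L T gamma N Nt n * h * fint T gamma f Nt n)) -E.
by field; rewrite gt_eqF.
Qed.

(** The terms of the scheme that contain [psi] and [f] at the interface are what is missing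
    in node [j] when the unknown at node [j + 1] is replaced by the ghost value, both at the
    new time and, if node [j] has just been passed, at the old time. *)
Lemma left_node m k : (m < Nt)%N -> (1 < jn m.+1)%N -> (jn m.+1 < N)%N ->
    (jn m.+1 <= (jn m).+1)%N -> (0 < k <= jn m.+1)%N -> xnode k <= gam m.+1 ->
  nodeop (tau / h ^+ 2) (v * h) (leftval m.+1) k
  = leftval m k + tau * f (xnode k, tnode m.+1).
Proof.
move=> mN j1 jN jj /andP[k0 kj] xg.
have kN : (k.-1 < N.-1)%N by lia.
pose i := Ordinal kN; have iE : i.+1 = k by rewrite /= prednK.
have := ns_step num mN => /(congr1 (fun c : 'cV_N.-1 => c i 0)).
set j := jn m.+1 in j1 jN jj kj *; set a := tau / h ^+ 2; set b := v * tau / (2 * h).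
have -> : (((1%:M + a *: Amx R N + b *: Bmx R N) *m cn m.+1)
   - (tau / h * psin m.+1) *: gridvec N (Eco L T v gamma dgamma N Nt m.+1)) i 0
  = (1 + 2 * a) * nodal (cn m.+1) k + (b - a) * nodal (cn m.+1) k.+1
    - (a + b) * nodal (cn m.+1) k.-1
    - tau / h * psin m.+1 * Eco L T v gamma dgamma N Nt m.+1 k.
  rewrite !mxE iE; congr (_ - _).
  rewrite /nodal !mulr_sumr -sumrN -!big_split /=; apply: eq_bigr => l _.
  rewrite !mxE /kron -iE /= !eqSS -(inj_eq val_inj i l) /=.
  by set p := (_ == _)%:R; ring.
rewrite !mxE iE /leftval /nodeop /Eco /Zco /ftilde -/j.
have k1 : kron R k j.+1 = 0 by apply: kron_neq; lia.
have k2 : kron R k 0 = 0 by apply: kron_neq; lia.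
have k3 : kron R k.-1 j.+1 = 0 by apply: kron_neq; lia.
have k4 : kron R k.+1 0 = 0 by [].
have k5 : kron R k.-1 0 = kron R 1 k by rewrite /kron; congr (_%:R); lia.
have k6 : kron R k (jn m).+1 = kron R k j * kron R (jn m).+1 j.
  rewrite /kron -natrM mulnb; congr (_%:R); lia.
rewrite k1 k2 k3 k4 k5 k6 kronS /fext xg !mul0r !mulr0 !addr0.
have lamh : a * h ^+ 2 = tau by rewrite /a divfK// expf_neq0// gt_eqF.
have rhoE : tau * rho L v N = a * (1 + v * h / 2).
  by rewrite /rho /a; field; rewrite gt_eqF.
have bE : b = a * (v * h / 2) by rewrite /b /a; field; rewrite gt_eqF.
have thE : tau / h = a * h by rewrite /a; field; rewrite gt_eqF.
have hh : h ^+ 2 / tau * tau = h ^+ 2 by rewrite divfK// gt_eqF.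
rewrite rhoE bE thE.
set C0 := nodal _ k.-1; set C1 := nodal _ k; set C2 := nodal _ k.+1.
set Ck := nodal (cn m) k.
have -> : cn m i 0 = Ck by rewrite -nodalE iE.
have a0 : a != 0 by rewrite gt_eqF// divr_gt0// exprn_gt0.
move=> E; apply/eqP; rewrite -subr_eq0; apply/eqP.
move/eqP: E; rewrite -subr_eq0 => /eqP <-.
rewrite -lamh; field.
by rewrite a0 gt_eqF.
Qed.

End LeftScheme.

(** * Taylor expansion *)

Section Taylor.
Variable R : realType.

(** The remainder has the remainder of order [m] of the derivative as its derivative, so the
    mean value theorem and induction apply.  Derivatives are needed in the open interval
    only. *)
Lemma taylor_bound (m : nat) (a b M c s : R) (F : nat -> R -> R) :
    (forall i, (i < m)%N -> {within `[a, b], continuous (F i)}) ->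
    (forall i x, (i < m)%N -> a < x < b -> is_derive x 1 (F i) (F i.+1 x)) ->
    (forall x, a <= x <= b -> `|F m x| <= M) ->
    a <= c <= b -> a <= s <= b ->
  `|F 0%N s - \sum_(i < m) F i c / i`!%:R * (s - c) ^+ i| <= M * `|s - c| ^+ m.
Proof.
elim: m F s => [|m IH] F s cF dF bF cab sab.
  by rewrite big_ord0 subr0 expr0 mulr1 bF.
pose p : {poly R} := \sum_(i < m.+1) (F i c / i`!%:R) *: ('X - c%:P) ^+ i.
pose G x := F 0%N x - p.[x].
have pE x : p.[x] = \sum_(i < m.+1) F i c / i`!%:R * (x - c) ^+ i.
  rewrite /p horner_sum; apply: eq_bigr => i _.
  by rewrite hornerZ horner_exp hornerXsubC.
have p'E x : p^`().[x] = \sum_(i < m) F i.+1 c / i`!%:R * (x - c) ^+ i.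
  rewrite /p raddf_sum horner_sum big_ord_recl /= expr0 derivZ derivC scaler0 horner0 add0r.
  apply: eq_bigr => i _; rewrite derivZ deriv_exp derivXsubC mul1r /= hornerZ.
  rewrite hornerMn horner_exp hornerXsubC /bump leq0n add1n add0n.
  rewrite factS -[_ *+ i.+1]mulr_natl.
  by rewrite mulnC natrM invfM !mulrA divfK// pnatr_eq0.
have Gc : G c = 0.
  rewrite /G pE big_ord_recl /= fact0 expr0 divr1 mulr1 big1 ?addr0 ?subrr// => i _.
  by rewrite ?subrr expr0n /= mulr0.
rewrite -pE -[X in `|X|]/(G s) -[G s]subr0 -Gc.
pose G' x := F 1%N x - p^`().[x].
have G'le x : a <= x <= b -> `|G' x| <= M * `|x - c| ^+ m.
  move=> xab; rewrite /G' p'E; apply: (IH (fun i => F i.+1)) => //.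
  - by move=> i im; apply: cF.
  - by move=> i y im; apply: dF.
have dG x : a < x < b -> is_derive x 1 G (G' x).
  move=> xab; apply: is_deriveB; first exact: dF.
have cG : {within `[a, b], continuous G}.
  apply: within_continuousB; first exact: cF.
  by apply: continuous_subspaceT => x; apply: continuous_horner.
have M0 : 0 <= M by apply: le_trans (bF c cab).
have key x y : a <= x <= b -> a <= y <= b -> x <= y ->
    exists2 z, x <= z <= y & G y - G x = G' z * (y - x).
  move=> /andP[ax xb] /andP[ay yb] xy.
  have [||z zxy E] := @MVT_segment R G G' x y xy.
  - move=> z; rewrite in_itv/= => /andP[xz zy]; apply: dG.
    by rewrite (le_lt_trans ax xz) (lt_le_trans zy yb).
  - apply: continuous_subspaceW cG; apply: subset_itv; rewrite bnd_simp//.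
  - by exists z => //; move: zxy; rewrite in_itv.
have Mle z : a <= z <= b -> `|z - c| <= `|s - c| -> `|G' z| * `|s - c| <= M * `|s - c| ^+ m.+1.
  move=> zab zs; rewrite exprSr mulrA ler_wpM2r//.
  apply: le_trans (G'le _ zab) _; rewrite ler_wpM2l//.
  by rewrite lerXn2r// nnegrE.
have [cs|sc] := leP c s.
  have [z /andP[z1 z2] ->] := key _ _ cab sab cs.
  rewrite normrM; apply: Mle; first by lra.
  by rewrite !ger0_norm ?subr_ge0//; lra.
have [z /andP[z1 z2] E] := key _ _ sab cab (ltW sc).
rewrite distrC E normrM [`|c - s|]distrC; apply: Mle; first by lra.
by rewrite !ler0_norm ?subr_le0//; lra.
Qed.

End Taylor.

(** * Limit points and limits *)

Section Limits.
Variable R : realType.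

(** Every passage to the boundary below is of this form: a path inside the set along which
    the function is known, ending at a point of the set. *)
Lemma cvg_within_comp (X Y : topologicalType) (Z : Type) (F : set_system Z)
    {FF : Filter F} (A : set X) (f : X -> Y) (g : Z -> X) (l : X) :
  {within A, continuous f} -> A l -> g @ F --> l -> (\forall z \near F, A (g z)) ->
  f (g z) @[z --> F] --> f l.
Proof.
move=> /subspace_continuousP/(_ l) cf Al gl Ag B /(cf Al) /gl.
by apply: filterS2 Ag => z Agz; apply.
Qed.

End Limits.

Section Domain.
Variable R : realType.
Implicit Types (T t : R) (G : R -> R).

(** A path that starts at [t] and enters the open interval [(0, T)] at once; it gives access
    to the times [0] and [T], where no derivatives are assumed. *)
Definition tpath T t (s : R) : R := t + s * (T / 2 - t).

Lemma affine_cvg0 (a b : R) : a + s * b @[s --> 0^'+] --> a.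
Proof.
apply: cvg_at_right_filter; rewrite -[X in _ --> X]addr0 -[X in _ + X](mul0r b).
by apply: cvgD; [exact: cvg_cst | apply: cvgMl; exact: cvg_id].
Qed.

Lemma tpath_near T t : 0 < T -> 0 <= t <= T ->
  \forall s \near 0^'+, 0 < tpath T t s < T.
Proof.
move=> T0 /andP[t0 tT]; near=> s.
have s0 : 0 < s by near: s; exact: nbhs_right_gt.
have s1 : s < 1 by near: s; exact: nbhs_right_lt.
rewrite /tpath; apply/andP; split; nra.
Unshelve. all: by end_near. Qed.

Definition under T G : set (R * R) :=
  [set p : R * R | 0 < p.2 < T /\ 0 < p.1 < G p.2].

Lemma within_cvg_tpath T t G : 0 < T -> {within `[0, T], continuous G} ->
  0 <= t <= T -> G (tpath T t s) @[s --> 0^'+] --> G t.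
Proof.
move=> T0 cG t0T; apply: (cvg_within_comp cG); first by rewrite /= in_itv.
  exact: affine_cvg0.
have := tpath_near T0 t0T; apply: filterS => s /andP[s0 sT].
by rewrite /= in_itv/= !ltW.
Qed.

(** Move the point along [tpath] and at the same time shift its relative height [p.1 / G p.2]
    towards [1/2]. *)
Lemma closure_under T G (p : R * R) : 0 < T -> {within `[0, T], continuous G} ->
    (forall t, 0 <= t <= T -> 0 < G t) -> 0 <= p.2 <= T -> 0 <= p.1 <= G p.2 ->
  closure (under T G) p.
Proof.
case: p => x t /= T0 cG G0 t0T /andP[x0 xG] B Bp.
have Gt := G0 _ t0T.
pose y := x / G t; pose P s := ((y + s * (1 / 2 - y)) * G (tpath T t s), tpath T t s).
have y0 : 0 <= y by rewrite divr_ge0// ltW.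
have y1 : y <= 1 by rewrite ler_pdivrMr// mul1r.
have cP : P s @[s --> 0^'+] --> (x, t).
  have c1 : (y + s * (1 / 2 - y)) * G (tpath T t s) @[s --> 0^'+] --> x.
    rewrite -[X in _ --> X](divfK (lt0r_neq0 Gt) x).
    apply: cvgM; first exact: affine_cvg0.
    exact: within_cvg_tpath.
  have c2 : tpath T t s @[s --> 0^'+] --> t by exact: affine_cvg0.
  exact: (cvg_pair c1 c2).
have nB : \forall s \near 0^'+, B (P s) by exact: cP.
have nU : \forall s \near 0^'+, under T G (P s).
  have nt := tpath_near T0 t0T.
  near=> s.
  have st : 0 < tpath T t s < T by near: s.
  have s0 : 0 < s by near: s; exact: nbhs_right_gt.
  have s1 : s < 1 by near: s; exact: nbhs_right_lt.
  have Gs : 0 < G (tpath T t s).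
    by apply: G0; case/andP: st => s2 s3; rewrite !ltW.
  split=> //=; apply/andP; split; first by rewrite mulr_gt0//; nra.
  by rewrite -[ltRHS]mul1r ltr_pM2r//; nra.
have [s [sU sB]] := filter_ex (filterI nU nB).
by exists (P s).
Unshelve. all: by end_near. Qed.

Lemma nbhs_under T G (p : R * R) : {for p.2, continuous G} -> under T G p ->
  nbhs p (under T G).
Proof.
move=> cG [/andP[t0 tT] /andP[x0 xG]].
have c1 : q.1 @[q --> p] --> p.1 by apply: cvg_fst.
have c2 : q.2 @[q --> p] --> p.2 by apply: cvg_snd.
have c3 : G q.2 - q.1 @[q --> p] --> G p.2 - p.1.
  by apply: cvgB => //; apply: (cvg_comp _ _ c2).
have xG' : 0 < G p.2 - p.1 by rewrite subr_gt0.
near=> q; split; apply/andP; split.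
- by near: q; apply: (cvgr_gt _ c2).
- by near: q; apply: (cvgr_lt _ c2).
- by near: q; apply: (cvgr_gt _ c1).
- by rewrite -subr_gt0; near: q; apply: (cvgr_gt _ c3).
Unshelve. all: by end_near. Qed.

(** The two functions may be continuous relative to different sets: the derivatives of [cp]
    live on the strip, the data on the closed left region. *)
Lemma closure_eq (X : topologicalType) (D A B : set X) (f g : X -> R) p :
    D `<=` A -> D `<=` B ->
    {within A, continuous f} -> {within B, continuous g} ->
    (forall x, D x -> f x = g x) -> closure D p -> A p -> B p ->
  f p = g p.
Proof.
move=> DA DB cf cg fg Dp Ap Bp.
have PF : ProperFilter (within D (nbhs p)).
  exact: within_nbhs_proper.
have Dn : \forall z \near within D (nbhs p), D z by exact: withinT.
have wid : z @[z --> within D (nbhs p)] --> p.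
  by move=> P; apply: filterS.
have cf' : f z @[z --> within D (nbhs p)] --> f p.
  apply: (cvg_within_comp cf) => //.
  by apply: filterS Dn => z; exact: DA.
have cg' : g z @[z --> within D (nbhs p)] --> g p.
  apply: (cvg_within_comp cg) => //.
  by apply: filterS Dn => z; exact: DB.
rewrite -(cvg_lim (@Rhausdorff R) cf'); apply: cvg_lim => //.
apply: cvg_trans cg'; apply: near_eq_cvg.
by apply: filterS Dn => z Dz; rewrite (fg _ Dz).
Qed.

End Domain.

(** * The strip around the fluid region *)

Section Interface.
Variables (R : realType) (L T r : R) (gamma dgamma : R -> R).
Hypotheses (T0 : 0 < T) (r0 : 0 < r).
Hypothesis hgamma : moving_interface L T gamma dgamma.
Hypothesis hstrip : OmegaGammaT T r gamma `<=` BT L T.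

Lemma at_right_le (F : R -> R) (l c : R) : F s @[s --> 0^'+] --> l ->
  (\forall s \near 0^'+, F s <= c) -> l <= c.
Proof.
move=> Fl Fc; rewrite -(cvg_lim (@Rhausdorff R) Fl); apply: limr_le => //.
by apply/cvg_ex; exists l.
Qed.

(** A strip of half-width [r] that reached [x = 0] or [x = L] would contain boundary points;
    the initial time follows by continuity. *)
Lemma strip_bounds t : 0 <= t <= T -> r <= gamma t /\ gamma t + r <= L.
Proof.
move=> tT.
have pos u : 0 < u <= T -> r <= gamma u /\ gamma u + r <= L.
  move=> uT; have /andP[u0 u1] := uT.
  have /andP[g0 gL] := mi_range hgamma (introT andP (conj (ltW u0) u1)).
  split; rewrite leNgt; apply/negP => H.
    have [|_ /=] := hstrip (_ : OmegaGammaT T r gamma (0, u)).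
      by split => //=; rewrite sub0r normrN gtr0_norm.
    by rewrite ltxx.
  have [|_ /=] := hstrip (_ : OmegaGammaT T r gamma (L, u)).
    by split => //=; rewrite gtr0_norm ?subr_gt0//; lra.
  by rewrite ltxx andbF.
have cg := within_cvg_tpath T0 (mi_cont hgamma) tT.
have nt := tpath_near T0 tT.
have npos : \forall s \near 0^'+, r <= gamma (tpath T t s) /\ gamma (tpath T t s) + r <= L.
  by apply: filterS nt => s /andP[s0 sT]; apply: pos; rewrite s0 ltW.
split; rewrite -subr_le0.
  apply: (@at_right_le (fun s => r - gamma (tpath T t s))).
    by apply: cvgB => //; exact: cvg_cst.
  by apply: filterS npos => s [+ _]; rewrite subr_le0.
apply: (@at_right_le (fun s => gamma (tpath T t s) + r - L)).
  by apply: cvgB; [apply: cvgD => //|]; exact: cvg_cst.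
by apply: filterS npos => s [_]; rewrite subr_le0.
Qed.

Local Notation strip := (closure (QT T gamma `|` OmegaGammaT T r gamma)).
Local Notation Gr := (fun t => gamma t + r).

Lemma within_gammaD a : {within `[0, T], continuous (fun t => gamma t + a)}.
Proof.
apply: within_continuousD; first exact: (mi_cont hgamma).
by apply: continuous_subspaceT => x; exact: cvg_cst.
Qed.

Lemma gamma_continuous t : 0 < t < T -> {for t, continuous gamma}.
Proof.
move=> tT; apply: differentiable_continuous; apply/derivable1_diffP.
by have := mi_deriv hgamma tT => ?; exact: ex_derive.
Qed.

Lemma under_strip : under T Gr `<=` QT T gamma `|` OmegaGammaT T r gamma.
Proof.
move=> [x t] [/= /andP[t0 tT] /andP[x0 xG]].
have tT' : 0 <= t <= T by rewrite !ltW.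
have [gr _] := strip_bounds tT'.
have [xg|xg] := ltP x (gamma t); [left|right]; split => /=; rewrite ?t0 ?x0 ?ltW//.
rewrite ger0_norm ?subr_ge0//; move: xG; lra.
Qed.

(** The interior is where [is_jet] provides derivatives. *)
Lemma under_interior p : under T Gr p -> interior strip p.
Proof.
move=> pG; have [tT _] := pG.
have cG : {for p.2, continuous Gr}.
  by apply: continuousD; [exact: gamma_continuous | exact: cvg_cst].
apply: filterS (nbhs_under cG pG).
by apply: subset_trans (@subset_closure _ _); exact: under_strip.
Qed.

Lemma left_interior p : under T gamma p -> interior (QT T gamma) p.
Proof.
move=> pG; have [tT _] := pG.
apply: filterS (nbhs_under (gamma_continuous tT) pG).
by move=> [x t] [/= /andP[t0 tT'] ?]; split; rewrite //= t0 ltW.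
Qed.

Lemma strip_mem (p : R * R) : 0 <= p.2 <= T -> 0 <= p.1 <= Gr p.2 -> strip p.
Proof.
move=> p2 p1; apply: (closureS under_strip); apply: closure_under => //.
  exact: within_gammaD.
by move=> t /strip_bounds[rt _]; rewrite addr_gt0// (lt_le_trans r0).
Qed.

Lemma left_closure (p : R * R) : 0 <= p.2 <= T -> 0 <= p.1 <= gamma p.2 ->
  closure (under T gamma) p.
Proof.
move=> p2 p1; apply: closure_under => //; first exact: (mi_cont hgamma).
by move=> t /strip_bounds[rt _]; rewrite (lt_le_trans r0).
Qed.

Lemma left_mem (p : R * R) : 0 <= p.2 <= T -> 0 <= p.1 <= gamma p.2 -> closure (QT T gamma) p.
Proof.
move=> p2 p1; apply: closureS (left_closure p2 p1).
by apply: subset_trans (@interior_subset _ _) => q; exact: left_interior.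
Qed.

Lemma cvg_slicex (Z : Type) (F : set_system Z) {FF : Filter F} (g : Z -> R) (x t : R) :
  g @ F --> x -> (g z, t) @[z --> F] --> (x, t).
Proof.
move=> gx; have ct : (fun _ : Z => t) @ F --> t by exact: cvg_cst.
exact: (cvg_pair gx ct).
Qed.

Lemma cvg_slicet (Z : Type) (F : set_system Z) {FF : Filter F} (g : Z -> R) (x t : R) :
  g @ F --> t -> (x, g z) @[z --> F] --> (x, t).
Proof.
move=> gt; have cx : (fun _ : Z => x) @ F --> x by exact: cvg_cst.
exact: (cvg_pair cx gt).
Qed.

Section Jet.
Variables (w : R * R -> R) (W : nat -> nat -> R * R -> R) (M : R).
Hypothesis jW : is_jet 4 2 strip w W.
Hypothesis WM : forall i j p, (i <= 4)%N -> (j <= 2)%N -> strip p -> `|W i j p| <= M.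

Lemma jet_slice i j (Z : topologicalType) (F : set_system Z) (FF : Filter F)
    (g : Z -> R * R) p : (i <= 4)%N -> (j <= 2)%N -> strip p ->
  g @ F --> p -> (\forall z \near F, strip (g z)) -> W i j (g z) @[z --> F] --> W i j p.
Proof.
move=> i4 j2; apply: cvg_within_comp.
by case: jW => _ cW _ _; exact: cW.
Qed.

(** At the times [0] and [T] the points are on the boundary, so the estimate is proved at
    inner times and passes to the limit. *)
Lemma space_taylor m t c s : (m <= 4)%N -> 0 <= t <= T ->
    0 <= c < gamma t + r -> 0 <= s < gamma t + r ->
  `|W 0 0 (s, t) - \sum_(i < m) W i 0%N (c, t) / i`!%:R * (s - c) ^+ i|
    <= M * `|s - c| ^+ m.
Proof.
move=> m4 tT /andP[c0 cG] /andP[s0 sG].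
pose b := Num.max c s.
have cb : c <= b by rewrite le_max lexx.
have sb : s <= b by rewrite le_max lexx orbT.
have bG : b < gamma t + r by rewrite gt_max cG.
have slices u : 0 < u < T -> b < gamma u + r ->
    `|W 0 0 (s, u) - \sum_(i < m) W i 0%N (c, u) / i`!%:R * (s - c) ^+ i|
      <= M * `|s - c| ^+ m.
  move=> uT bu.
  have mem x : 0 <= x <= b -> strip (x, u).
    move=> /andP[x0 xb]; apply: strip_mem => /=.
      by case/andP: uT => u0 u1; rewrite !ltW.
    by rewrite x0 ltW// (le_lt_trans xb).
  apply: (@taylor_bound _ m 0 b M c s (fun i x => W i 0%N (x, u))).
  - move=> i im; apply/subspace_continuousP => x xb.
    apply: jet_slice => //; first exact: (leq_trans (ltnW im)).
      by apply: mem; move: xb; rewrite /= in_itv.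
    + apply: cvg_slicex => P; exact: filterS.
    + by apply: filterS (withinT _ _) => y; rewrite /= in_itv/=; exact: mem.
  - move=> i x im /andP[x0 xb]; case: jW => _ _ dW _.
    apply: (dW i (x, u)); first exact: (leq_trans im).
    by apply: under_interior; split=> //=; rewrite x0 (lt_trans xb).
  - by move=> x xb; apply: WM => //; exact: mem.
  - by rewrite c0.
  - by rewrite s0.
have ct : gamma (tpath T t z) @[z --> 0^'+] --> gamma t.
  exact: within_cvg_tpath (mi_cont hgamma) tT.
have nt := tpath_near T0 tT.
have nG : \forall z \near 0^'+, b < gamma (tpath T t z) + r.
  have : gamma (tpath T t z) + r @[z --> 0^'+] --> gamma t + r.
    by apply: cvgD => //; exact: cvg_cst.
  by move/cvgr_gt; apply.
have lim i x : (i <= 4)%N -> 0 <= x <= b ->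
    W i 0%N (x, tpath T t z) @[z --> 0^'+] --> W i 0%N (x, t).
  move=> i4 /andP[x0 xb]; apply: jet_slice => //.
  - by apply: strip_mem => //=; rewrite x0 ltW// (le_lt_trans xb).
  - by apply: cvg_slicet; exact: affine_cvg0.
  - near=> z.
    have zT : 0 < tpath T t z < T by near: z.
    have zG : b < gamma (tpath T t z) + r by near: z.
    apply: strip_mem => /=; first by case/andP: zT => ? ?; rewrite !ltW.
    by rewrite x0 ltW// (le_lt_trans xb).
apply: (@at_right_le (fun z => `|W 0 0 (s, tpath T t z)
   - \sum_(i < m) W i 0%N (c, tpath T t z) / i`!%:R * (s - c) ^+ i|)).
  apply: cvg_norm; apply: cvgB; first by apply: lim; rewrite ?s0.
  apply: cvg_big => [|i _]; first exact: add_continuous.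
  apply: cvgMl; apply: cvgMl; apply: lim; last by rewrite c0.
  by rewrite (leq_trans (ltnW _) m4).
by near=> z; apply: slices; near: z.
Unshelve. all: by end_near. Qed.

Lemma time_taylor x t1 t2 : 0 <= t1 -> t1 < t2 -> t2 <= T ->
    (forall t, t1 <= t <= t2 -> 0 < x < gamma t + r) ->
  `|W 0 0 (x, t1) - W 0 0 (x, t2) - W 0 1 (x, t2) * (t1 - t2)|
    <= M * (t2 - t1) ^+ 2.
Proof.
move=> t10 t12 t2T xG.
have mem t : t1 <= t <= t2 -> strip (x, t).
  move=> tt; have /andP[x0 xg] := xG _ tt; case/andP: tt => ta tb.
  by apply: strip_mem => /=; [apply/andP; split; lra | rewrite !ltW].
suff : `|W 0 0 (x, t1) - \sum_(j < 2) W 0%N j (x, t2) / j`!%:R * (t1 - t2) ^+ j|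
    <= M * `|t1 - t2| ^+ 2.
  rewrite !big_ord_recl big_ord0 /= !fact0 expr0 expr1 !divr1 mulr1 addr0 opprD addrA.
  have -> // : `|t1 - t2| ^+ 2 = (t2 - t1) ^+ 2.
  by rewrite -normrX ger0_norm ?sqr_ge0//; ring.
apply: (@taylor_bound _ 2 t1 t2 M t2 t1 (fun j t => W 0%N j (x, t))).
- move=> j j2; apply/subspace_continuousP => t tb.
  have {}tb : t1 <= t <= t2 by move: tb; rewrite /= in_itv.
  apply: jet_slice => //; [exact: ltnW | exact: mem | |].
  + by apply: cvg_slicet => P; exact: filterS.
  + by apply: filterS (withinT _ _) => y; rewrite /= in_itv/=; exact: mem.
- move=> j t j2 /andP[ta tb]; case: jW => _ _ _ dW.
  apply: (dW 0%N j (x, t)) => //.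
  apply: under_interior; split=> /=; first by apply/andP; split; lra.
  by apply: xG; rewrite !ltW.
- by move=> t tt; apply: WM => //; exact: mem.
- by rewrite ltW//=.
- by rewrite lexx ltW.
Qed.

End Jet.
End Interface.

(** * Equations satisfied by the smooth extension *)

Section Traces.
Variables (R : realType) (L T v r : R) (gamma dgamma : R -> R).
Variables (f : R * R -> R) (g q c0 : R -> R) (c cp : R * R -> R).
Variable W : nat -> nat -> R * R -> R.
Hypotheses (T0 : 0 < T) (r0 : 0 < r).
Hypothesis hgamma : moving_interface L T gamma dgamma.
Hypothesis hstrip : OmegaGammaT T r gamma `<=` BT L T.
Local Notation strip := (closure (QT T gamma `|` OmegaGammaT T r gamma)).
Hypothesis exact_c : exact_solution T v gamma dgamma f g q c0 c.
Hypothesis cp_c : forall p, QT T gamma p -> cp p = c p.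
Hypothesis jW : is_jet 4 2 strip cp W.

Let jW_cont i j : (i <= 4)%N -> (j <= 2)%N -> {within strip, continuous (W i j)}.
Proof. by case: jW => _ cW _ _; exact: cW. Qed.

Let region p : 0 <= p.2 <= T -> 0 <= p.1 <= gamma p.2 -> strip p.
Proof.
move=> p2 /andP[p1 p3]; apply: (strip_mem T0 r0 hgamma hstrip) => //.
by rewrite p1 (le_trans p3)// lerDl ltW.
Qed.

Let under_region p : under T gamma p -> strip p.
Proof. by move=> [/andP[? ?] /andP[? ?]]; apply: region; rewrite !ltW. Qed.

Let under_left : under T gamma `<=` closure (QT T gamma).
Proof.
move=> p [/andP[? ?] /andP[? ?]].
by apply: (left_mem T0 r0 hgamma hstrip); rewrite !ltW.
Qed.

Let under_QT p : under T gamma p -> QT T gamma p.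
Proof. by move=> [/andP[p0 pT] ?]; split => //; rewrite p0 ltW. Qed.

Let W_under p : under T gamma p -> W 0 0 p = c p.
Proof.
move=> pU; case: jW => W0 _ _ _; rewrite W0; last exact: under_region.
by apply: cp_c; exact: under_QT.
Qed.

(** On the closed left region the continuous extension [W 0 0] of [cp] and the exact solution
    have the same values, since they agree on the dense part where both are given. *)
Lemma jet_trace p : 0 <= p.2 <= T -> 0 <= p.1 <= gamma p.2 -> W 0 0 p = c p.
Proof.
move=> p2 p1; have [V [V0 cV _ _]] := es_reg exact_c.
have pC := left_mem T0 r0 hgamma hstrip p2 p1.
rewrite -(V0 _ pC); apply: (closure_eq under_region under_left (jW_cont _ _)) => //.
- exact: cV.
- by move=> x xU; rewrite W_under// V0//; exact: under_left.
- exact: (left_closure T0 r0 hgamma hstrip).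
- exact: region.
Qed.

Let slice_near x t : under T gamma (x, t) -> \forall y \near x, under T gamma (y, t).
Proof.
move=> [tT /andP[x0 xg]].
have id_x : y @[y --> x] --> x by exact: cvg_id.
near=> y; split => //=; apply/andP; split; near: y.
  exact: (cvgr_gt _ id_x).
exact: (cvgr_lt _ id_x).
Unshelve. all: by end_near. Qed.

Let is_derive_eq (F G : R -> R) (x a b : R) : is_derive x 1 F a -> is_derive x 1 G b ->
  (\forall y \near x, F y = G y) -> a = b.
Proof.
move=> dF dG FG; have dF' := near_eq_is_derive FG dF.
by rewrite -(@derive_val _ _ _ _ _ _ _ dF') -(@derive_val _ _ _ _ _ _ _ dG).
Qed.

Let under_int p : under T gamma p -> interior strip p.
Proof.
move=> [pT /andP[p0 pg]]; apply: (under_interior T0 hgamma hstrip).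
by split; rewrite // p0 (lt_trans pg)// ltrDl.
Qed.

(** The jets of [c] in the differential equation and of [cp] need not be the same functions,
    but their derivatives agree in the open left region by uniqueness of derivatives. *)
Lemma jet_pde p : 0 <= p.2 <= T -> 0 <= p.1 <= gamma p.2 ->
  W 0 1 p + v * W 1 0 p - W 2 0 p = f p.
Proof.
move=> p2 p1; have [V [V0 cV dV dtV] pde] := es_pde exact_c.
have pC := left_mem T0 r0 hgamma hstrip p2 p1.
pose lhs p := W 0 1 p + v * W 1 0 p - W 2 0 p.
apply: (@closure_eq _ _ (under T gamma) strip (closure (QT T gamma)) lhs f p
  under_region under_left).
- apply: within_continuousB; last exact: jW_cont.
  apply: within_continuousD; first exact: jW_cont.
  by move=> x; apply: cvgMr; exact: jW_cont.
- exact: es_fcont exact_c.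
- case: jW => _ _ dW dtW.
  have VW00 y : under T gamma y -> W 0 0 y = V 0%N 0%N y.
    by move=> yU; rewrite W_under// V0//; exact: under_QT.
  have int_QT y : under T gamma y -> interior (QT T gamma) y.
    exact: (left_interior hgamma).
  have VW10 y : under T gamma y -> W 1 0 y = V 1%N 0%N y.
    case: y => x t yU; apply: (is_derive_eq (dW 0%N (x, t) _ _) (dV 0%N (x, t) _ _)) => //.
    + exact: under_int.
    + exact: int_QT.
    + by apply: filterS (slice_near yU) => y /VW00.
  have VW20 y : under T gamma y -> W 2 0 y = V 2%N 0%N y.
    case: y => x t yU; apply: (is_derive_eq (dW 1%N (x, t) _ _) (dV 1%N (x, t) _ _)) => //.
    + exact: under_int.
    + exact: int_QT.
    + by apply: filterS (slice_near yU) => y /VW10.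
  have VW01 y : under T gamma y -> W 0 1 y = V 0%N 1%N y.
    case: y => x t yU; apply: (is_derive_eq (dtW 0%N 0%N (x, t) _ _ _)
      (dtV 0%N 0%N (x, t) _ _ _)) => //.
    + exact: under_int.
    + exact: int_QT.
    + have [tT _] := yU.
      have ct : u @[u --> t] --> t by exact: cvg_id.
      have nU := cvg_slicet (FF := nbhs_filter t) (x := x) ct
        (nbhs_under (gamma_continuous hgamma tT) yU).
      exact: (@filterS R (nbhs t) (nbhs_filter t) _ _ (fun u => VW00 (x, u)) nU).
  move=> y yU; rewrite /lhs VW01// VW10// VW20// pde; last exact: under_QT.
  by rewrite addrC addKr.
- exact: (left_closure T0 r0 hgamma hstrip).
- exact: region.
- exact: pC.
Qed.

(** For inner times the one-sided limit of the derivative of [c] is the value of the continuous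
    function [W 1 0]; the times [0] and [T] follow by continuity of the data. *)
Lemma jet_robin t : 0 <= t <= T ->
  W 1 0 (gamma t, t) + alpha v dgamma t * W 0 0 (gamma t, t) = g t.
Proof.
have inner u : 0 < u < T ->
    W 1 0 (gamma u, u) + alpha v dgamma u * W 0 0 (gamma u, u) = g u.
  move=> uT; have /andP[u0 uT'] := uT.
  have uTc : 0 <= u <= T by rewrite !ltW.
  have gu : 0 < gamma u by case/andP: (mi_range hgamma uTc).
  have [|cx [dcx <-]] := es_robin exact_c (t := u); first by rewrite u0 ltW.
  have gg : 0 <= gamma u <= gamma u by rewrite lexx ltW.
  rewrite (jet_trace (p := (gamma u, u)))//; congr (_ + _).
  have left_under : \forall x \near (gamma u)^'-, under T gamma (x, u).
    near=> x; split => //=; apply/andP; split; near: x.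
      exact: nbhs_left_gt.
    exact: nbhs_left_lt.
  have cW : W 1 0 (x, u) @[x --> (gamma u)^'-] --> W 1 0 (gamma u, u).
    apply: (jet_slice jW) => //; first exact: region.
      by apply: cvg_slicex => P; exact: cvg_within.
    by apply: filterS left_under => x; exact: under_region.
  rewrite -(cvg_lim (@Rhausdorff R) dcx); apply/esym/cvg_lim => //.
  apply: cvg_trans cW; apply: near_eq_cvg.
  near=> x.
  have xU : under T gamma (x, u) by near: x.
  rewrite /Dx derive1E /=.
  have dW : is_derive x 1 (fun y => W 0 0 (y, u)) (W 1 0 (x, u)).
    by case: jW => _ _ dW _; apply: (dW 0%N (x, u)) => //; exact: under_int.
  have eqW : \forall y \near x, W 0 0 (y, u) = c (y, u).
    by apply: filterS (slice_near xU) => y; exact: W_under.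
  by rewrite (@derive_val _ _ _ _ _ _ _ (near_eq_is_derive eqW dW)).
move=> tT.
pose P z := (gamma (tpath T t z), tpath T t z).
have cg := within_cvg_tpath T0 (mi_cont hgamma) tT.
have cd := within_cvg_tpath T0 (mi_dcont hgamma) tT.
have nt := tpath_near T0 tT.
have tt : tpath T t z @[z --> 0^'+] --> t by exact: affine_cvg0.
have gt : 0 < gamma t by case/andP: (mi_range hgamma tT).
have cP : P z @[z --> 0^'+] --> (gamma t, t) by exact: (cvg_pair cg tt).
have cW i j : (i <= 4)%N -> (j <= 2)%N ->
    W i j (P z) @[z --> 0^'+] --> W i j (gamma t, t).
  move=> i4 j2; apply: (jet_slice jW) => //.
    by apply: region; rewrite //= lexx ltW.
  apply: filterS nt => z /andP[z0 zT]; have zTc : 0 <= tpath T t z <= T by rewrite !ltW.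
  by apply: region; rewrite //= lexx ltW//; case/andP: (mi_range hgamma zTc).
have lhs : W 1 0 (P z) + (dgamma (tpath T t z) - v) * W 0 0 (P z) @[z --> 0^'+]
    --> W 1 0 (gamma t, t) + alpha v dgamma t * W 0 0 (gamma t, t).
  apply: cvgD; first exact: cW.
  by apply: cvgM; [apply: cvgB => //; exact: cvg_cst | exact: cW].
rewrite -(cvg_lim (@Rhausdorff R) lhs); apply: cvg_lim => //.
have := within_cvg_tpath T0 (es_gcont exact_c) tT.
apply: cvg_trans; apply: near_eq_cvg.
by apply: filterS nt => z zT; rewrite -inner.
Unshelve. all: by end_near. Qed.

End Traces.

(** * Truncation errors *)

Section Remainders.
Variable R : realType.

Lemma node_remainder (A B C O w1 w2 w3 wt fx h tau v lam M : R) :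
    0 < h -> 0 < tau -> 0 <= M ->
    `|O - B + wt * tau| <= M * tau ^+ 2 ->
    `|C - (B + w1 * h + w2 / 2 * h ^+ 2 + w3 / 6 * h ^+ 3)| <= M * h ^+ 4 ->
    `|A - (B - w1 * h + w2 / 2 * h ^+ 2 - w3 / 6 * h ^+ 3)| <= M * h ^+ 4 ->
    `|C - (B + w1 * h + w2 / 2 * h ^+ 2)| <= M * h ^+ 3 ->
    `|A - (B - w1 * h + w2 / 2 * h ^+ 2)| <= M * h ^+ 3 ->
    wt + v * w1 - w2 = fx -> lam = tau / h ^+ 2 ->
  `|(1 + 2 * lam) * B - lam * (1 + v * h / 2) * A - lam * (1 - v * h / 2) * C
     - O - tau * fx| <= tau * (M * (2 + `|v|) * (tau + h ^+ 2)).
Proof.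
move=> h0 tau0 M0 Et E4p E4m E3p E3m pde lamE; rewrite -{}pde.
have h2 : h ^+ 2 != 0 by rewrite expf_neq0// gt_eqF.
have lam0 : 0 < lam by rewrite lamE divr_gt0// exprn_gt0.
have tauE : tau = lam * h ^+ 2 by rewrite lamE divfK.
move: Et E4p E4m E3p E3m.
set et := O - B + _; set e4p := C - (_ + w3 / 6 * _); set e4m := A - (_ - w3 / 6 * _).
set e3p := C - _; set e3m := A - _ => Et E4p E4m E3p E3m.
have -> : (1 + 2 * lam) * B - lam * (1 + v * h / 2) * A - lam * (1 - v * h / 2) * C
     - O - tau * (wt + v * w1 - w2)
  = - et - lam * (e4p + e4m) + lam * (v * h / 2) * (e3p - e3m).
  by rewrite /et /e4p /e4m /e3p /e3m tauE; field.
have b1 : `|lam * (e4p + e4m)| <= lam * (2 * (M * h ^+ 4)).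
  rewrite normrM (gtr0_norm lam0) ler_pM2l//.
  by apply: le_trans (ler_normD _ _) _; lra.
have b2 : `|lam * (v * h / 2) * (e3p - e3m)| <= lam * (`|v| * h / 2) * (2 * (M * h ^+ 3)).
  rewrite !normrM (gtr0_norm lam0) (gtr0_norm h0) [`|2^-1|]ger0_norm//.
  apply: ler_wpM2l; first by rewrite !mulr_ge0// ltW.
  by apply: le_trans (ler_normB _ _) _; lra.
apply: le_trans (ler_normD _ _) _.
apply: le_trans (lerD (ler_normB _ _) b2) _; rewrite normrN.
apply: le_trans (lerD (lerD Et b1) (lexx _)) _.
have -> : lam * (2 * (M * h ^+ 4)) = tau * (2 * M * h ^+ 2) by rewrite tauE; ring.
have -> : lam * (`|v| * h / 2) * (2 * (M * h ^+ 3)) = tau * (`|v| * M * h ^+ 2).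
  by rewrite tauE; field.
have t0 : 0 <= tau * tau * M by rewrite !mulr_ge0// ltW.
have t1 : 0 <= tau * tau * M * `|v| by rewrite mulr_ge0.
by lra.
Qed.

(** The weights reproduce the derivative of quadratic polynomials and the value of affine
    ones, which is why expansions of order three and two suffice. *)
Lemma robin_remainder (A B C w0 w1 w2 h s al M : R) :
    0 < h -> 0 <= M -> 0 <= s < 1 ->
    `|A - (w0 - w1 * ((1 + s) * h) + w2 / 2 * ((1 + s) * h) ^+ 2)| <= M * ((1 + s) * h) ^+ 3 ->
    `|B - (w0 - w1 * (s * h) + w2 / 2 * (s * h) ^+ 2)| <= M * (s * h) ^+ 3 ->
    `|C - (w0 + w1 * ((1 - s) * h) + w2 / 2 * ((1 - s) * h) ^+ 2)| <= M * ((1 - s) * h) ^+ 3 ->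
    `|B - (w0 - w1 * (s * h))| <= M * (s * h) ^+ 2 ->
    `|C - (w0 + w1 * ((1 - s) * h))| <= M * ((1 - s) * h) ^+ 2 ->
  `|(s - 2^-1) * A + (- 2 * s + (1 - s) * (al * h)) * B
     + (s + 2^-1 + s * (al * h)) * C - h * (w1 + al * w0)|
    <= h * (M * (8 + `|al|) * h ^+ 2).
Proof.
move=> h0 M0 /andP[s0 s1] EA EB EC FB FC.
have sh p : 0 <= p <= 1 -> forall n, M * (p * h) ^+ n <= M * h ^+ n.
  move=> /andP[p0 p1] n; rewrite ler_wpM2l// lerXn2r ?nnegrE ?mulr_ge0 ?(ltW h0)//.
  by rewrite ler_piMl// ltW.
have s01 : 0 <= s <= 1 by rewrite s0 ltW.
have s01' : 0 <= 1 - s <= 1 by apply/andP; split; lra.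
have {}EB := le_trans EB (sh _ s01 3%N); have {}FB := le_trans FB (sh _ s01 2%N).
have {}EC := le_trans EC (sh _ s01' 3%N); have {}FC := le_trans FC (sh _ s01' 2%N).
have {}EA : `|A - (w0 - w1 * ((1 + s) * h) + w2 / 2 * ((1 + s) * h) ^+ 2)|
    <= 8 * (M * h ^+ 3).
  apply: le_trans EA _; rewrite (_ : 8 * _ = M * (2 * h) ^+ 3); last by ring.
  rewrite ler_wpM2l// lerXn2r ?nnegrE ?mulr_ge0 ?(ltW h0)//; first lra.
  by rewrite ler_pM2r//; lra.
move: EA EB EC FB FC.
set eA := A - _; set eB := B - _; set eC := C - _; set dB := B - _; set dC := C - _.
move=> EA EB EC FB FC.
have -> : (s - 2^-1) * A + (- 2 * s + (1 - s) * (al * h)) * B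
     + (s + 2^-1 + s * (al * h)) * C - h * (w1 + al * w0)
  = (s - 2^-1) * eA - 2 * s * eB + (s + 2^-1) * eC
    + al * h * ((1 - s) * dB + s * dC).
  by rewrite /eA /eB /eC /dB /dC; field.
have nA : `|(s - 2^-1) * eA| <= 2^-1 * (8 * (M * h ^+ 3)).
  rewrite normrM; apply: ler_pM => //.
  by rewrite ler_norml; apply/andP; split; lra.
have nB : `|2 * s * eB| <= 2 * (M * h ^+ 3).
  rewrite normrM; apply: ler_pM => //.
  by rewrite ler_norml; apply/andP; split; lra.
have nC : `|(s + 2^-1) * eC| <= 2 * (M * h ^+ 3).
  rewrite normrM; apply: ler_pM => //.
  by rewrite ler_norml; apply/andP; split; lra.
have nD : `|al * h * ((1 - s) * dB + s * dC)| <= `|al| * h * (M * h ^+ 2).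
  rewrite !normrM (gtr0_norm h0); apply: ler_wpM2l; first by rewrite mulr_ge0// ltW.
  apply: le_trans (ler_normD _ _) _; rewrite !normrM.
  have -> : M * h ^+ 2 = (1 - s) * (M * h ^+ 2) + s * (M * h ^+ 2) by ring.
  rewrite (ger0_norm s0) (ger0_norm (_ : 0 <= 1 - s)); last by lra.
  by apply: lerD; apply: ler_wpM2l => //; lra.
apply: le_trans (ler_normD _ _) _.
apply: le_trans (lerD (le_trans (ler_normD _ _) (lerD (ler_normB _ _) (lexx _))) (lexx _)) _.
have : 0 <= M * h ^+ 3 by rewrite mulr_ge0// exprn_ge0// ltW.
by lra.
Qed.

End Remainders.

Section Truncation.
Variables (R : realType) (L T v r : R) (gamma dgamma : R -> R).
Variables (f : R * R -> R) (g q c0 : R -> R) (c cp : R * R -> R).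
Variables (W : nat -> nat -> R * R -> R) (M : R).
Hypotheses (T0 : 0 < T) (r0 : 0 < r).
Hypothesis hgamma : moving_interface L T gamma dgamma.
Hypothesis hstrip : OmegaGammaT T r gamma `<=` BT L T.
Local Notation strip := (closure (QT T gamma `|` OmegaGammaT T r gamma)).
Hypothesis exact_c : exact_solution T v gamma dgamma f g q c0 c.
Hypothesis cp_c : forall p, QT T gamma p -> cp p = c p.
Hypothesis jW : is_jet 4 2 strip cp W.
Hypothesis WM : forall i j p, (i <= 4)%N -> (j <= 2)%N -> strip p -> `|W i j p| <= M.

Lemma bound_ge0 : 0 <= M.
Proof.
apply: le_trans (WM (i := 0) (j := 0) (p := (0, 0)) _ _ _) => //.
have T00 : 0 <= (0 : R) <= T by rewrite lexx ltW.
apply: (strip_mem T0 r0 hgamma hstrip) => //=.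
by rewrite lexx addr_ge0 ?ltW//; case/andP: (mi_range hgamma T00).
Qed.


Lemma node_truncation x h t1 t2 lam : 0 < h -> 0 <= t1 -> t1 < t2 -> t2 <= T ->
    0 <= x - h -> x <= gamma t2 -> x + h < gamma t2 + r ->
    (forall t, t1 <= t <= t2 -> 0 < x < gamma t + r) -> lam = (t2 - t1) / h ^+ 2 ->
  `|(1 + 2 * lam) * W 0 0 (x, t2) - lam * (1 + v * h / 2) * W 0 0 (x - h, t2)
     - lam * (1 - v * h / 2) * W 0 0 (x + h, t2) - W 0 0 (x, t1)
     - (t2 - t1) * f (x, t2)|
  <= (t2 - t1) * (M * (2 + `|v|) * (t2 - t1 + h ^+ 2)).
Proof.
move=> h0 t10 t12 t2T xh xg xr xG lamE.
have t2T' : 0 <= t2 <= T by rewrite t2T andbT (le_trans t10)// ltW.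
have x0 : 0 <= x by lra.
have gr : 0 <= x < gamma t2 + r by apply/andP; split; lra.
have xp : 0 <= x + h < gamma t2 + r by apply/andP; split; lra.
have xm : 0 <= x - h < gamma t2 + r by apply/andP; split; lra.
have tay m s (m4 : (m <= 4)%N) :=
  @space_taylor _ _ _ _ _ _ T0 r0 hgamma hstrip _ _ _ jW WM m t2 x s m4 t2T' gr.
have M0 := bound_ge0.
have dp : x + h - x = h by ring.
have dm : x - h - x = - h by ring.
apply: (@node_remainder _ _ _ _ _ (W 1 0 (x, t2)) (W 2 0 (x, t2)) (W 3 0 (x, t2))
  (W 0 1 (x, t2))) => //.
- by rewrite subr_gt0.
- have := time_taylor T0 r0 hgamma hstrip jW WM t10 t12 t2T xG.
  by rewrite -[t1 - t2]opprB mulrN opprK.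
- have := tay 4%N _ isT xp; rewrite dp !big_ord_recr big_ord0 /= (gtr0_norm h0).
  by rewrite !add0r expr0 mulr1 !divr1 expr1.
- have := tay 4%N _ isT xm; rewrite dm !big_ord_recr big_ord0 /= normrN (gtr0_norm h0).
  rewrite !add0r expr0 mulr1 !divr1 expr1 sqrrN mulrN.
  by rewrite (_ : (- h) ^+ 3 = - h ^+ 3) ?mulrN//; ring.
- have := tay 3%N _ isT xp; rewrite dp !big_ord_recr big_ord0 /= (gtr0_norm h0).
  by rewrite !add0r expr0 mulr1 !divr1 expr1.
- have := tay 3%N _ isT xm; rewrite dm !big_ord_recr big_ord0 /= normrN (gtr0_norm h0).
  by rewrite !add0r expr0 mulr1 !divr1 expr1 sqrrN mulrN.
- by apply: (jet_pde T0 r0 hgamma hstrip exact_c cp_c jW) => //=; rewrite x0.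
Qed.

Lemma robin_truncation h s t : 0 < h -> 0 <= s < 1 -> 0 <= t <= T ->
    2 * h <= gamma t -> h < r ->
  `|(s - 2^-1) * W 0 0 (gamma t - (1 + s) * h, t)
     + (- 2 * s + (1 - s) * (alpha v dgamma t * h)) * W 0 0 (gamma t - s * h, t)
     + (s + 2^-1 + s * (alpha v dgamma t * h)) * W 0 0 (gamma t + (1 - s) * h, t)
     - h * g t|
  <= h * (M * (8 + `|alpha v dgamma t|) * h ^+ 2).
Proof.
move=> h0 s01 tT gh hr; have /andP[s0 s1] := s01.
have gr : 0 <= gamma t < gamma t + r by apply/andP; split; lra.
have tay m y (m4 : (m <= 4)%N) :=
  @space_taylor _ _ _ _ _ _ T0 r0 hgamma hstrip _ _ _ jW WM m t (gamma t) y m4 tT gr.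
have M0 := bound_ge0.
have sh0 : 0 <= s * h by rewrite mulr_ge0// ltW.
have sh1 : s * h <= h by rewrite ler_piMl// ltW.
have in1 : 0 <= gamma t - (1 + s) * h < gamma t + r by apply/andP; split; lra.
have in2 : 0 <= gamma t - s * h < gamma t + r by apply/andP; split; lra.
have in3 : 0 <= gamma t + (1 - s) * h < gamma t + r by apply/andP; split; lra.
have d1 : gamma t - (1 + s) * h - gamma t = - ((1 + s) * h) by ring.
have d2 : gamma t - s * h - gamma t = - (s * h) by ring.
have d3 : gamma t + (1 - s) * h - gamma t = (1 - s) * h by ring.
have p1 : 0 <= (1 + s) * h by lra.
have p3 : 0 <= (1 - s) * h by lra.
rewrite -(jet_robin T0 r0 hgamma hstrip exact_c cp_c jW tT).
apply: (@robin_remainder _ _ _ _ _ (W 1 0 (gamma t, t)) (W 2 0 (gamma t, t))) => //.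
- have := tay 3%N _ isT in1; rewrite d1 !big_ord_recr big_ord0 /= normrN (ger0_norm p1).
  by rewrite !add0r expr0 mulr1 !divr1 expr1 sqrrN mulrN.
- have := tay 3%N _ isT in2; rewrite d2 !big_ord_recr big_ord0 /= normrN (ger0_norm sh0).
  by rewrite !add0r expr0 mulr1 !divr1 expr1 sqrrN mulrN.
- have := tay 3%N _ isT in3; rewrite d3 !big_ord_recr big_ord0 /= (ger0_norm p3).
  by rewrite !add0r expr0 mulr1 !divr1 expr1.
- have := tay 2%N _ isT in2; rewrite d2 !big_ord_recr big_ord0 /= normrN (ger0_norm sh0).
  by rewrite !add0r expr0 mulr1 !divr1 expr1 mulrN.
- have := tay 2%N _ isT in3; rewrite d3 !big_ord_recr big_ord0 /= (ger0_norm p3).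
  by rewrite !add0r expr0 mulr1 !divr1 expr1.
Qed.

End Truncation.

(** * Position of the interface on the grid *)

Section Grid.
Variables (R : realType) (L T v r : R) (gamma dgamma : R -> R) (N Nt : nat).
Hypotheses (L0 : 0 < L) (T0 : 0 < T) (r0 : 0 < r).
Hypothesis hgamma : moving_interface L T gamma dgamma.
Hypothesis hstrip : OmegaGammaT T r gamma `<=` BT L T.
Hypotheses (N0 : (0 < N)%N) (Nt0 : (0 < Nt)%N).
Local Notation h := (hstep L N).
Local Notation tau := (tstep T Nt).
Local Notation jn := (jn L T gamma N Nt).
Local Notation gam := (gam T gamma Nt).
Local Notation sig := (sig L T gamma N Nt).
Local Notation tnode := (tnode T Nt).
Local Notation xnode := (xnode L N).

Lemma hstep_gt0 : 0 < h. Proof. by rewrite divr_gt0// ltr0n. Qed.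
Lemma tstep_gt0 : 0 < tau. Proof. by rewrite divr_gt0// ltr0n. Qed.

Lemma xnode_size : xnode N = L.
Proof. by rewrite /xnode /hstep mulrC divfK// pnatr_eq0 -lt0n. Qed.

Lemma tnodeS m : tnode m.+1 = tnode m + tau.
Proof. by rewrite /tnode -natr1 mulrDl mul1r. Qed.

Lemma tnode_itv n : (n <= Nt)%N -> 0 <= tnode n <= T.
Proof.
move=> nN; rewrite /tnode mulr_ge0 ?ler0n ?(ltW tstep_gt0)//=.
by rewrite /tstep mulrA ler_pdivrMr ?ltr0n// mulrC ler_pM2l// ler_nat.
Qed.

Lemma natS_hstep k : k.+1%:R * h = k%:R * h + h.
Proof. by rewrite -natr1 mulrDl mul1r. Qed.

Lemma jn_itv n : (n <= Nt)%N -> (jn n)%:R * h <= gam n < (jn n).+1%:R * h.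
Proof.
move=> nN; have /andP[g0 _] := mi_range hgamma (tnode_itv nN).
have := truncn_itv (divr_ge0 (ltW g0) (ltW hstep_gt0)).
by rewrite ler_pdivlMr ?ltr_pdivrMr ?hstep_gt0.
Qed.

Lemma sig_gam n : gam n = (jn n)%:R * h + sig n * h.
Proof.
by rewrite /sig mulrBl divfK ?gt_eqF ?hstep_gt0// addrC subrK.
Qed.

Lemma sig_itv n : (n <= Nt)%N -> 0 <= sig n < 1.
Proof.
move=> nN; have h0 := hstep_gt0; have := jn_itv nN; rewrite sig_gam natS_hstep.
rewrite lerDl pmulr_lge0// ltrD2l -{2}[h]mul1r ltr_pM2r//.
Qed.

Lemma xnode_le_gam n k : (n <= Nt)%N -> (k <= jn n)%N -> xnode k <= gam n.
Proof.
move=> nN kj; have /andP[+ _] := jn_itv nN; apply: le_trans.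
by rewrite /xnode ler_pM2r ?hstep_gt0// ler_nat.
Qed.

Hypothesis hr : 4 * h <= r.

Lemma jn_gt1 n : (n <= Nt)%N -> (1 < jn n)%N.
Proof.
move=> nN; have /andP[_ ] := jn_itv nN.
have [+ _] := strip_bounds T0 hgamma hstrip (tnode_itv nN); rewrite -/(gam n) => rg gj.
have := le_lt_trans (le_trans hr rg) gj; rewrite ltr_pM2r ?hstep_gt0// ltr_nat.
by lia.
Qed.

Lemma jn_size n : (n <= Nt)%N -> ((jn n).+1 < N)%N.
Proof.
move=> nN; have h0 := hstep_gt0; have /andP[jg _ ] := jn_itv nN.
have [_] := strip_bounds T0 hgamma hstrip (tnode_itv nN); rewrite -/(gam n) => rg.
have : xnode (jn n).+1 < xnode N.
  rewrite xnode_size /xnode natS_hstep; have := hr; have := r0; lra.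
by rewrite /xnode ltr_pM2r// ltr_nat.
Qed.

Lemma gamma_lipschitz S t1 t2 : (forall t, 0 <= t <= T -> `|dgamma t| <= S) ->
  0 <= t1 -> t1 <= t2 -> t2 <= T -> `|gamma t2 - gamma t1| <= S * (t2 - t1).
Proof.
move=> dS t10 t12 t2T.
have [||t] := @MVT_segment R gamma dgamma t1 t2 t12.
- move=> t; rewrite in_itv/= => /andP[ta tb]; apply: (mi_deriv hgamma).
  by rewrite (le_lt_trans t10 ta) (lt_le_trans tb).
- apply: continuous_subspaceW (mi_cont hgamma).
  by apply: subset_itv; rewrite bnd_simp.
rewrite in_itv/= => /andP[ta tb] ->; rewrite normrM [`|t2 - t1|]ger0_norm ?subr_ge0//.
by rewrite ler_wpM2r ?subr_ge0// dS// (le_trans t10 ta) (le_trans tb).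
Qed.

(** The interface travels less than one cell per time step. *)
Lemma jn_step S m : (forall t, 0 <= t <= T -> `|dgamma t| <= S) -> tau * S < h ->
  (m < Nt)%N -> (jn m.+1 <= (jn m).+1)%N.
Proof.
move=> dS Sh mN; have h0 := hstep_gt0; have tau0 := tstep_gt0.
have /andP[j1 _] := jn_itv mN; have /andP[_ j2] := jn_itv (ltnW mN).
have /andP[t1 _] := tnode_itv (ltnW mN); have /andP[_ t2] := tnode_itv mN.
have t12 : tnode m <= tnode m.+1 by rewrite tnodeS lerDl ltW.
have := gamma_lipschitz dS t1 t12 t2; rewrite -/(gam m) -/(gam m.+1) tnodeS.
rewrite ler_norml [_ + tau - _]addrC addrA addNr add0r mulrC => /andP[_ gS].
have : (jn m.+1)%:R * h < (jn m).+2%:R * h.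
  by move: j2; rewrite !natS_hstep => j2; lra.
by rewrite ltr_pM2r// ltr_nat ltnS.
Qed.

End Grid.

(** * The error estimate for a given barrier *)

(** What the stability argument asks of a supersolution: [K] is the rate of growth in time,
    and [gh] tells whether the interface may gain a node, in which case the Robin inequality
    must hold with a surplus proportional to [phi]. *)
Record barrier (R : realType) (L T v : R) (gamma dgamma : R -> R) (N Nt : nat)
    (K : R) (gh : bool) (phi : nat -> R) : Prop := Barrier {
  br_growth : 0 <= K;
  br_step : K * tstep T Nt <= 2^-1;
  br_jump : forall m, (m < Nt)%N -> (jn L T gamma N Nt m.+1 <= jn L T gamma N Nt m + gh)%N;
  br_gt0 : forall k, k%:R * hstep L N <= L -> 0 < phi k;
  br_gh : gh -> forall k, 4 * hstep L N <= phi k;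
  br_node : forall k, (0 < k)%N -> (1 - K * tstep T Nt) * phi k + tstep T Nt
    <= nodeop (tstep T Nt / hstep L N ^+ 2) (v * hstep L N) phi k;
  br_robin : forall n, (n <= Nt)%N ->
    hstep L N + gh%:R * (2 * (`|alph T v dgamma Nt n * hstep L N| + 2 * `|v * hstep L N|)
        * phi (jn L T gamma N Nt n))
    <= robinop (sig L T gamma N Nt n) (alph T v dgamma Nt n * hstep L N) phi
         (jn L T gamma N Nt n)
}.

Section Convergence.
Variables (R : realType) (L T v r S : R) (gamma dgamma : R -> R) (N Nt : nat).
Hypotheses (L0 : 0 < L) (T0 : 0 < T) (r0 : 0 < r).
Hypothesis hgamma : moving_interface L T gamma dgamma.
Hypothesis hstrip : OmegaGammaT T r gamma `<=` BT L T.
Hypotheses (N0 : (0 < N)%N) (Nt0 : (0 < Nt)%N).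
Local Notation h := (hstep L N).
Local Notation tau := (tstep T Nt).
Local Notation jn := (jn L T gamma N Nt).
Local Notation gam := (gam T gamma Nt).
Local Notation sig := (sig L T gamma N Nt).
Local Notation alph := (alph T v dgamma Nt).
Local Notation tnode := (tnode T Nt).
Local Notation xnode := (xnode L N).
Hypothesis dS : forall t : R, 0 <= t <= T -> `|dgamma t| <= S.
Hypothesis cfl : tau * S < h.
Hypotheses (hr : 4 * h <= r) (hsmall : (S + `|v|) * h <= 4^-1).
Hypothesis parab : 2^-1 * h ^+ 2 <= tau.

Lemma speed_ge0 : 0 <= S.
Proof. by apply: le_trans (dS (t := 0) _) => //; rewrite lexx ltW. Qed.

Lemma alpha_le t : 0 <= t <= T -> `|alpha v dgamma t| <= S + `|v|.
Proof. by move=> tT; apply: le_trans (ler_normB _ _) _; rewrite lerD2r dS. Qed.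

Section Error.
Variables (f : R * R -> R) (g q c0 : R -> R) (c cp : R * R -> R).
Variables (W : nat -> nat -> R * R -> R) (M : R).
Local Notation strip := (closure (QT T gamma `|` OmegaGammaT T r gamma)).
Hypothesis exact_c : exact_solution T v gamma dgamma f g q c0 c.
Hypothesis cp_c : forall p, QT T gamma p -> cp p = c p.
Hypothesis jW : is_jet 4 2 strip cp W.
Hypothesis WM : forall i j p, (i <= 4)%N -> (j <= 2)%N -> strip p -> `|W i j p| <= M.
Variables (cn : nat -> 'cV[R]_N.-1) (psin : nat -> R).
Hypothesis num : numerical_solution L T v gamma dgamma f g q Nt cn psin.
Hypothesis init : forall k, (0 < k <= jn 0%N)%N -> nodal (cn 0%N) k = c (xnode k, tnode 0).
Variables (K : R) (gh : bool) (phi : nat -> R).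
Hypothesis bar : barrier L T v gamma dgamma N Nt K gh phi.

Let h0 : 0 < h := hstep_gt0 L0 N0.
Let tau0 : 0 < tau := tstep_gt0 T0 Nt0.
Let u := leftval L T v gamma dgamma f q Nt cn psin.
Let e n k := W 0 0 (xnode k, tnode n) - u n k.
Let delta := M * (10 + `|v| + (S + `|v|)) * (tau + h ^+ 2).
Let M0 : 0 <= M := bound_ge0 T0 r0 hgamma hstrip WM.

Let left_nodal n k : (0 < k <= jn n)%N -> u n k = nodal (cn n) k.
Proof.
move=> /andP[k0 kj]; rewrite /u /leftval !kron_neq ?mul0r ?addr0//; lia.
Qed.

Let grid_trace n k : (n <= Nt)%N -> (k <= jn n)%N ->
  W 0 0 (xnode k, tnode n) = c (xnode k, tnode n).
Proof.
move=> nN kj; apply: (jet_trace T0 r0 hgamma hstrip exact_c cp_c jW) => /=.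
  exact: tnode_itv.
apply/andP; split; first by rewrite mulr_ge0// ltW.
exact: (xnode_le_gam L0 T0 hgamma).
Qed.

Let xnodeS k : xnode k.+1 = xnode k + h.
Proof. by rewrite /xnode natS_hstep. Qed.

Let error_node m k : (m < Nt)%N -> (0 < k <= jn m.+1)%N ->
  `|nodeop (tau / h ^+ 2) (v * h) (e m.+1) k - e m k| <= tau * delta.
Proof.
move=> mN kk; have /andP[k0 kj] := kk.
have [[[hh0 tt0] MM0] rr0] := (h0, tau0, M0, r0).
have S0 := speed_ge0.
have jj := jn_step L0 T0 hgamma N0 Nt0 dS cfl mN.
have xg : xnode k <= gam m.+1 by exact: (xnode_le_gam L0 T0 hgamma).
have E := left_node h0 tau0 num mN (jn_gt1 L0 T0 r0 hgamma hstrip N0 Nt0 hr mN)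
   (ltnW (jn_size L0 T0 r0 hgamma hstrip N0 Nt0 hr mN)) jj kk xg.
have /andP[t1 _] := tnode_itv T0 Nt0 (ltnW mN); have /andP[_ t2] := tnode_itv T0 Nt0 mN.
have t12 : tnode m < tnode m.+1 by rewrite tnodeS ltrDl.
have tauE : tnode m.+1 - tnode m = tau by rewrite tnodeS addrC addKr.
have xm : xnode k - h = xnode k.-1 by rewrite -{1}(prednK k0) xnodeS addrK.
have xp : xnode k + h = xnode k.+1 by rewrite xnodeS.
have x1 : 0 <= xnode k.-1 by rewrite mulr_ge0// ltW.
have := @node_truncation R L T v r gamma dgamma f g q c0 c cp W M T0 r0 hgamma hstrip
  exact_c cp_c jW WM (xnode k) h (tnode m) (tnode m.+1) (tau / h ^+ 2) h0 t1 t12 t2.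
rewrite tauE xm xp => /(_ x1 xg _ _ erefl) trunc.
have {trunc} : `|nodeop (tau / h ^+ 2) (v * h) (e m.+1) k - e m k|
    <= tau * (M * (2 + `|v|) * (tau + h ^+ 2)).
  rewrite (_ : _ - _ = (1 + 2 * (tau / h ^+ 2)) * W 0 0 (xnode k, tnode m.+1)
     - tau / h ^+ 2 * (1 + v * h / 2) * W 0 0 (xnode k.-1, tnode m.+1)
     - tau / h ^+ 2 * (1 - v * h / 2) * W 0 0 (xnode k.+1, tnode m.+1)
     - W 0 0 (xnode k, tnode m) - tau * f (xnode k, tnode m.+1)); last first.
    move/eqP: E; rewrite -subr_eq0 => /eqP E.
    rewrite -[RHS]subr0 -E /nodeop /e /u; ring.
  apply: trunc.
    have := xg; rewrite -xp /gam; have := hr; lra.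
  move=> t /andP[ta tb]; apply/andP; split.
    by rewrite mulr_gt0// ltr0n.
  have := gamma_lipschitz hgamma dS (le_trans t1 ta) tb t2.
  rewrite ler_norml -/(gam m.+1) => /andP[_ gS].
  have : S * (tnode m.+1 - t) <= S * tau by rewrite ler_wpM2l// -tauE; lra.
  by have := hr; have := cfl; rewrite mulrC; lra.
move=> H; apply: le_trans H _; rewrite ler_pM2l// /delta ler_wpM2r//.
  by rewrite addr_ge0 ?exprn_ge0// ltW.
by rewrite ler_wpM2l//; have := normr_ge0 v; lra.
Qed.

Let error_robin n : (n <= Nt)%N ->
  `|robinop (sig n) (alph n * h) (e n) (jn n)| <= h * delta.
Proof.
move=> nN; have [[[hh0 tt0] MM0] rr0] := (h0, tau0, M0, r0).
have S0 := speed_ge0.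
have j1 := jn_gt1 L0 T0 r0 hgamma hstrip N0 Nt0 hr nN.
have E := left_robin h0 tau0 num nN j1.
have tT := tnode_itv T0 Nt0 nN.
have s01 := sig_itv L0 T0 hgamma N0 Nt0 nN.
have [rg _] := strip_bounds T0 hgamma hstrip tT.
have gE : gamma (tnode n) = xnode (jn n) + sig n * h.
  exact: (sig_gam T gamma Nt L0 N0).
have := @robin_truncation R L T v r gamma dgamma f g q c0 c cp W M T0 r0 hgamma hstrip
  exact_c cp_c jW WM h (sig n) (tnode n) h0 s01 tT.
have h1 : 2 * h <= gamma (tnode n) by have := hr; lra.
have h2 : h < r by have := hr; lra.
move=> /(_ h1 h2).
have -> : gamma (tnode n) - (1 + sig n) * h = xnode (jn n).-1.
  by rewrite gE -{1}(prednK (ltnW j1)) xnodeS; ring.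
have -> : gamma (tnode n) - sig n * h = xnode (jn n) by rewrite gE addrK.
have -> : gamma (tnode n) + (1 - sig n) * h = xnode (jn n).+1.
  by rewrite gE xnodeS; ring.
rewrite -/(alph n) => H.
have -> : robinop (sig n) (alph n * h) (e n) (jn n) =
  (sig n - 2^-1) * W 0 0 (xnode (jn n).-1, tnode n)
  + (- 2 * sig n + (1 - sig n) * (alph n * h)) * W 0 0 (xnode (jn n), tnode n)
  + (sig n + 2^-1 + sig n * (alph n * h)) * W 0 0 (xnode (jn n).+1, tnode n)
  - h * g (tnode n).
  by rewrite -E /robinop /e /u; ring.
apply: le_trans H _; rewrite ler_pM2l// /delta.
have aS : `|alph n| <= S + `|v| by exact: alpha_le.
apply: (@le_trans _ _ (M * (10 + `|v| + (S + `|v|)) * h ^+ 2)).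
  rewrite ler_wpM2r ?exprn_ge0 ?(ltW h0)// ler_wpM2l//.
  by have := normr_ge0 v; lra.
by rewrite ler_wpM2l ?mulr_ge0 ?lerDr ?(ltW tau0)//; have := normr_ge0 v; lra.
Qed.

(** The factor [10 + |v| + (S + |v|)] dominates [2 + |v|] from the nodes and [8 + |alpha|] from
    the Robin condition. *)
Lemma error_bound n k : (n <= Nt)%N -> (0 < k <= jn n)%N ->
  `|c (xnode k, tnode n) - nodal (cn n) k|
    <= M * (10 + `|v| + (S + `|v|)) * (tau + h ^+ 2) * (1 + 2 * K * tau) ^+ n * phi k.
Proof.
move=> nN kj; rewrite -grid_trace//; last by case/andP: kj.
rewrite -(left_nodal kj) -/(e n k) -/delta.
have [[hh0 tt0] S0] := (h0, tau0, speed_ge0).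
have small x : `|x| <= S + `|v| -> `|x * h| <= 4^-1.
  move=> xS; rewrite normrM (gtr0_norm h0); apply: le_trans hsmall.
  by rewrite ler_pM2r.
have range i j : (i <= Nt)%N -> (j <= (jn i).+1)%N -> j%:R * h <= L.
  move=> iN ji; rewrite -[leRHS](xnode_size L N0) /xnode ler_pM2r// ler_nat.
  exact: leq_trans ji (ltnW (jn_size L0 T0 r0 hgamma hstrip N0 Nt0 hr iN)).
apply: (@stability R h tau v K delta Nt gh jn sig alph phi e) => //.
- exact: br_growth bar.
- exact: br_step bar.
- rewrite /delta !mulr_ge0 ?addr_ge0 ?exprn_ge0 ?(ltW h0) ?(ltW tau0)//.
- by apply: small; rewrite lerDr.
- move=> i iN; split; [apply: small; apply: alpha_le; exact: tnode_itv
    | exact: (sig_itv L0 T0 hgamma N0 Nt0 iN) |].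
  exact: (jn_gt1 L0 T0 r0 hgamma hstrip N0 Nt0 hr iN).
- exact: br_jump bar.
- by move=> i j iN ji; apply: (br_gt0 bar); exact: (range i).
- by move=> ghT; exact: (br_gh bar ghT).
- by move=> i j iN /andP[j0 _]; exact: (br_node bar j0).
- exact: br_robin bar.
- move=> m mN; rewrite /e /u /leftval nodal0 (kronii R) mul1r add0r kron_neq // mul0r addr0.
  rewrite grid_trace// /xnode mul0r (es_inflow exact_c) ?subrr//.
  have /andP[_ ->] := tnode_itv T0 Nt0 mN; rewrite andbT.
  by rewrite mulr_gt0// ltr0n.
- move=> j jj; rewrite /e (left_nodal jj) init// grid_trace ?subrr//.
  by case/andP: jj.
Qed.

End Error.
End Convergence.

(** * Existence of barriers and convergence *)

Section Existence.
Variables (R : realType) (L T v r S : R) (gamma dgamma : R -> R) (N Nt : nat).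
Hypotheses (L0 : 0 < L) (T0 : 0 < T) (r0 : 0 < r).
Hypothesis hgamma : moving_interface L T gamma dgamma.
Hypothesis hstrip : OmegaGammaT T r gamma `<=` BT L T.
Hypotheses (N0 : (0 < N)%N) (Nt0 : (0 < Nt)%N).
Local Notation h := (hstep L N).
Local Notation tau := (tstep T Nt).
Local Notation jn := (jn L T gamma N Nt).
Hypothesis dS : forall t : R, 0 <= t <= T -> `|dgamma t| <= S.
Hypothesis cfl : tau * S < h.
Hypothesis hr : 4 * h <= r.

(** The rate that [expbar_robin] asks for, with [S + |v|] as a bound for [alpha], and the
    growth in time that [expbar_node] then costs. *)
Definition exprate : R := 6 * (S + `|v|) + 8 * `|v| + 2.
Definition expgrowth : R := exprate ^+ 2 + 2 * `|v| * exprate + 1.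

Lemma exprate_ge2 : 0 <= S -> 2 <= exprate.
Proof. by move=> S0; rewrite /exprate; have := normr_ge0 v; lra. Qed.

Lemma expgrowth_gt0 : 0 <= S -> 0 < expgrowth.
Proof.
move=> S0; have := exprate_ge2 S0; rewrite /expgrowth => b2.
have := mulr_ge0 (normr_ge0 v) (le_trans (ler0n _ 2) b2).
have := sqr_ge0 exprate; lra.
Qed.

Lemma expbar_barrier : 0 < S -> exprate * h <= 4^-1 ->
  h * (2 * expgrowth) <= S -> barrier L T v gamma dgamma N Nt expgrowth true (expbar exprate h).
Proof.
move=> S0 bh KS.
have [h0 tau0] := (hstep_gt0 L0 N0, tstep_gt0 T0 Nt0).
have b2 := exprate_ge2 (ltW S0); have b0 : 0 < exprate by lra.
have K0 := expgrowth_gt0 (ltW S0).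
have ge1 k : 1 <= expbar exprate h k.
  by rewrite /expbar exprn_ege1// lerDl mulr_ge0// ltW.
split.
- exact: ltW.
- rewrite -(ler_pM2r S0); have := ler_wpM2l (ltW K0) (ltW cfl); lra.
- by move=> m mN; rewrite addn1; exact: (jn_step L0 T0 hgamma N0 Nt0 dS cfl).
- by move=> k _; exact: lt_le_trans (ge1 k).
- move=> _ k; apply: le_trans (ge1 k).
  have := ler_wpM2r (ltW h0) b2; lra.
- by move=> k k0; apply: expbar_node.
- move=> n nN; rewrite mul1r; have tT := tnode_itv T0 Nt0 nN.
  apply: (@expbar_robin R exprate h v _ _ (S + `|v|)) => //.
  + exact: (sig_itv L0 T0 hgamma N0 Nt0 nN).
  + exact: (alpha_le v dS).
  + exact: ltnW (jn_gt1 L0 T0 r0 hgamma hstrip N0 Nt0 hr nN).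
Qed.

Lemma fluxbar_barrier : S = 0 -> `|v * h| <= 4^-1 ->
  h * `|v| * (`|v| * ((5 + 4 * L) * expR ((2 * `|v| + 1) * L)) + 2 + 2 * L) <= 1 ->
  barrier L T v gamma dgamma N Nt 0 false (fluxbar v L h).
Proof.
move=> S0 vh small.
have [h0 tau0] := (hstep_gt0 L0 N0, tstep_gt0 T0 Nt0).
split => //.
- by rewrite mul0r.
- move=> m mN; rewrite addn0 /jn.
  have /andP[t1 _] := tnode_itv T0 Nt0 (ltnW mN); have /andP[_ t2] := tnode_itv T0 Nt0 mN.
  have t12 : tnode T Nt m <= tnode T Nt m.+1 by rewrite tnodeS lerDl ltW.
  have := gamma_lipschitz hgamma dS t1 t12 t2; rewrite S0 mul0r normr_le0 subr_eq0.
  by rewrite /Defs.jn /gam => /eqP ->.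
- by move=> k kL; apply: fluxbar_gt0.
- move=> k k0; rewrite mul0r subr0 mul1r fluxbar_node//.
- move=> n nN; rewrite mul0r addr0; have tT := tnode_itv T0 Nt0 nN.
  have -> : alph T v dgamma Nt n = - v.
    rewrite /alph /alpha; have := dS tT; rewrite S0 normr_le0 => /eqP ->.
    by rewrite sub0r.
  apply: fluxbar_robin => //.
  + exact: (sig_itv L0 T0 hgamma N0 Nt0 nN).
  + exact: ltnW (jn_gt1 L0 T0 r0 hgamma hstrip N0 Nt0 hr nN).
  + rewrite -[leRHS](xnode_size L N0) /xnode ler_pM2r// ler_nat.
    exact: ltnW (jn_size L0 T0 r0 hgamma hstrip N0 Nt0 hr nN).
Qed.

End Existence.

Section Selection.
Variables (R : realType) (T : R) (dgamma : R -> R).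
Hypotheses (T0 : 0 < T) (cd : {within `[0, T], continuous dgamma}).

Lemma speed_le_sup t : 0 <= t <= T ->
  `|dgamma t| <= sup [set `|dgamma t| | t in `[0, T]].
Proof.
move=> tT; apply: ub_le_sup; last by exists t => //; rewrite /= in_itv.
have cn : {within `[0, T], continuous (fun t => `|dgamma t|)}.
  by move=> x; apply: cvg_norm; exact: cd.
have [s _ smax] := EVT_max (ltW T0) cn.
by exists `|dgamma s| => _ [u uT <-]; exact: smax.
Qed.

End Selection.

(** The two cases cannot be merged: a barrier that grows in time needs [K tau <= 1/2], which
    the step restriction implies only if the speed [S] of the interface is positive. *)
Lemma barrier_exists (R : realType) (L T v r S : R) (gamma dgamma : R -> R) :
    0 < L -> 0 < T -> 0 < r -> moving_interface L T gamma dgamma ->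
    OmegaGammaT T r gamma `<=` BT L T ->
    (forall t : R, 0 <= t <= T -> `|dgamma t| <= S) ->
  exists2 h0 : R, 0 < h0 & exists2 Phi : R, 0 <= Phi &
  forall N Nt : nat, (0 < N)%N -> (0 < Nt)%N ->
    hstep L N <= h0 -> tstep T Nt * S < hstep L N ->
  [/\ 4 * hstep L N <= r, (S + `|v|) * hstep L N <= 4^-1
    & exists K gh phi, barrier L T v gamma dgamma N Nt K gh phi /\
      forall n k, (n <= Nt)%N -> k%:R * hstep L N <= L ->
        (1 + 2 * K * tstep T Nt) ^+ n * phi k <= Phi].
Proof.
move=> L0 T0 r0 hgamma hstrip dS.
have S0 : 0 <= S by exact: (speed_ge0 T0 dS).
have V0 := normr_ge0 v.
have mulh (h0 a b : R) : 0 < a -> h0 <= b / a -> a * h0 <= b.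
  by move=> a0; rewrite ler_pdivlMr// mulrC.
have [Sgt0|S_le0] := ltP 0 S.
  pose b := exprate v S; pose K := expgrowth v S.
  have b2 : 2 <= b := exprate_ge2 v S0; have K0 : 0 < K := expgrowth_gt0 v S0.
  exists (Num.min (r / 4) (Num.min (4^-1 / b) (S / (2 * K)))).
    rewrite !lt_min !divr_gt0// ?mulr_gt0//; lra.
  exists (expR (2 * K * T) * expR (b * L)); first by rewrite mulr_ge0// expR_ge0.
  move=> N Nt N0 Nt0; have h0 := hstep_gt0 L0 N0; have tau0 := tstep_gt0 T0 Nt0.
  rewrite !le_min => /andP[/mulh h1 /andP[/mulh h2 /mulh h3]] cfl.
  have {}h1 : 4 * hstep L N <= r by exact: h1.
  have {}h2 : b * hstep L N <= 4^-1 by apply: h2; lra.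
  have {}h3 : 2 * K * hstep L N <= S by apply: h3; rewrite mulr_gt0.
  split => //.
    by apply: le_trans h2; rewrite ler_pM2r// /b /exprate; lra.
  exists K, true, (expbar b (hstep L N)); split.
    by apply: (@expbar_barrier _ _ _ _ r) => //; rewrite mulrC.
  move=> n k nN kL; apply: ler_pM.
  - by have := mulr_gt0 K0 tau0 => Kt; apply: exprn_ge0; lra.
  - by have := mulr_ge0 (le_trans (ler0n _ 2) b2) (ltW h0) => bh; apply: exprn_ge0; lra.
  - apply: (@expbar_le _ (2 * K) (tstep T Nt) T n); [lra | exact: ltW |].
    by case/andP: (tnode_itv T0 Nt0 nN).
  - by apply: expbar_le => //; [lra | exact: ltW].
have {S_le0} S_eq0 : S = 0 by apply/eqP; rewrite eq_le S_le0.
pose Phi := (5 + 4 * L) * expR ((2 * `|v| + 1) * L).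
have Phi0 : 0 <= Phi by rewrite mulr_ge0 ?expR_ge0//; lra.
pose G := `|v| * (`|v| * Phi + 2 + 2 * L).
have G0 : 0 <= G by rewrite !(mulr_ge0, addr_ge0)// ltW.
exists (Num.min (r / 4) (Num.min (4^-1 / (1 + `|v|)) (1 / (1 + G)))).
  rewrite !lt_min !divr_gt0//; lra.
exists Phi => // N Nt N0 Nt0; have h0 := hstep_gt0 L0 N0.
rewrite !le_min => /andP[/mulh h1 /andP[/mulh h2 /mulh h3]] cfl.
have {}h1 : 4 * hstep L N <= r by exact: h1.
have {}h2 : (1 + `|v|) * hstep L N <= 4^-1 by apply: h2; lra.
have {}h3 : (1 + G) * hstep L N <= 1 by apply: h3; lra.
have vh : `|v| * hstep L N <= 4^-1 by lra.
split => //; first by rewrite S_eq0 add0r.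
exists 0, false, (fluxbar v L (hstep L N)); split.
  apply: (@fluxbar_barrier _ _ _ _ r S) => //.
    by rewrite normrM (gtr0_norm h0).
  by rewrite -/Phi -mulrA -/G mulrC; lra.
move=> n k nN kL; rewrite mulr0 mul0r addr0 expr1n mul1r.
by apply: fluxbar_le => //; rewrite normrM (gtr0_norm h0).
Qed.

Lemma Rmx_nodal (R : realType) (L T : R) (gamma : R -> R) (N Nt n : nat)
    (u : 'cV[R]_N.-1) (i : 'I_(jn L T gamma N Nt n)) :
  (Rmx L T gamma N Nt n *m u) i 0 = nodal u i.+1.
Proof.
rewrite mxE /nodal; apply: eq_bigr => l _.
by rewrite !mxE ltn_ord andbT /kron eqSS.
Qed.

Lemma nodal_gridvec (R : realType) (N k : nat) (w : nat -> R) :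
  (0 < k < N)%N -> nodal (gridvec N w) k = w k.
Proof.
case: k => // k /andP[_ kN]; have kN' : (k < N.-1)%N by lia.
by rewrite (nodalE _ (Ordinal kN')) mxE.
Qed.

Theorem theorem4p13 (R : realType) (L T v r : R) (gamma dgamma : R -> R)
    (hL : 0 < L) (hT : 0 < T) (hr : 0 < r)
    (hgamma : moving_interface L T gamma dgamma)
    (hstrip : OmegaGammaT T r gamma `<=` BT L T)
    (hmono : (forall t : R, 0 <= t <= T -> 0 <= dgamma t) \/
             (forall t : R, 0 <= t <= T -> dgamma t <= 0)) :
  exists2 h0 : R, 0 < h0 & forall M : R, exists C : R,
  forall (f : R * R -> R) (g q c0 : R -> R) (c : R * R -> R) (psi : R -> R)
    (F corr cp cm : R * R -> R),
  exact_solution T v gamma dgamma f g q c0 c ->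
  extended_solution L T v gamma dgamma f g q c0 c psi ->
  correction_function T v r gamma f c F corr cp cm psi ->
  bounded_by L T v r gamma dgamma f g q c0 c corr cp M ->
  forall alpha0 beta : R,
  (forall t : R, 0 <= t <= T -> alpha0 <= alpha v dgamma t) ->
  Num.max (`|alpha0| + 1) `|v| < beta ->
  forall N Nt : nat, (0 < N)%N -> (0 < Nt)%N ->
  let h := hstep L N in
  let tau := tstep T Nt in
  h <= h0 ->
  2^-1 * h ^+ 2 <= tau ->
  tau * sup [set `|dgamma t| | t in `[0, T]] < h ->
  forall (cn : nat -> 'cV[R]_N.-1) (psin : nat -> R),
  numerical_solution L T v gamma dgamma f g q Nt cn psin ->
  Rmx L T gamma N Nt 0 *m cn 0%N
    = Rmx L T gamma N Nt 0 *m Cvec L T N Nt c 0 ->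
  \big[Num.max/0]_(n < Nt.+1)
     `|Rmx L T gamma N Nt n *m (Cvec L T N Nt c n - cn n)|
    <= C * expR (C * T + beta * L) * (tau + h ^+ 2).
Proof.
pose S := sup [set `|dgamma t| | t in `[0, T]].
have dS : forall t, 0 <= t <= T -> `|dgamma t| <= S.
  exact: (speed_le_sup hT (mi_dcont hgamma)).
have [h0 h0_gt0 [Phi Phi0 barP]] :=
  barrier_exists v hL hT hr hgamma hstrip dS.
exists h0 => // M; pose C := `|M| * (10 + `|v| + (S + `|v|)) * Phi; exists C.
move=> f g q c0 c psi F corr cp cm exact_c _ corr_c bounds alpha0 beta _ beta_gt.
move=> N Nt N0 Nt0 h tau hh0 parab cfl cn psin num init.
have [hsmall1 hsmall2 [K [gh [phi [bar barPhi]]]]] := barP N Nt N0 Nt0 hh0 cfl.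
have [W jW WM] := bb_cp bounds.
have S0 : 0 <= S by exact: (speed_ge0 hT dS).
have V0 := normr_ge0 v.
have hgt0 : 0 < h := hstep_gt0 hL N0; have tau0 : 0 < tau := tstep_gt0 hT Nt0.
have C0 : 0 <= C by rewrite !(mulr_ge0, addr_ge0).
have beta0 : 0 < beta.
  by apply: le_lt_trans beta_gt; rewrite le_max V0 orbT.
have step0 : 0 <= tau + h ^+ 2 by rewrite addr_ge0 ?exprn_ge0 ?(ltW hgt0) ?(ltW tau0).
(* The exponent is nonnegative, so the exponential factor is at least one. *)
have target : C * (tau + h ^+ 2) <= C * expR (C * T + beta * L) * (tau + h ^+ 2).
  rewrite ler_wpM2r// ler_peMr// -expR0 ler_expR.
  by rewrite addr_ge0// mulr_ge0 ?(ltW hT) ?(ltW beta0) ?(ltW hL).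
have sizeN n : (n <= Nt)%N -> ((jn L T gamma N Nt n).+1 < N)%N.
  exact: (jn_size hL hT hr hgamma hstrip N0 Nt0 hsmall1).
apply: bigmax_le => [|n _]; first by apply: le_trans target; rewrite mulr_ge0.
have nN : (n <= Nt)%N by rewrite -ltnS.
apply: le_trans target; rewrite [leLHS]mx_normrE.
apply: bigmax_le => [|[i j] _ /=]; first by rewrite mulr_ge0.
rewrite (ord1 j) {j} mulmxBr mxE [X in _ + X]mxE !Rmx_nodal.
have iN : (0 < i.+1 <= jn L T gamma N Nt n)%N by rewrite ltn_ord.
have in_grid m k : (m <= Nt)%N -> (0 < k <= jn L T gamma N Nt m)%N ->
    nodal (Cvec L T N Nt c m) k = c (xnode L N k, tnode T Nt m).
  move=> mN /andP[k0 kj]; rewrite nodal_gridvec// k0/=.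
  by apply: leq_ltn_trans kj (ltnW (sizeN m mN)).
rewrite in_grid//.
have init' k : (0 < k <= jn L T gamma N Nt 0)%N ->
    nodal (cn 0%N) k = c (xnode L N k, tnode T Nt 0).
  case: k => // k kj; have kj' : (k < jn L T gamma N Nt 0)%N by case/andP: kj.
  rewrite -in_grid//; have := congr1 (fun A : 'cV_(_) => A (Ordinal kj') 0) init.
  by rewrite !Rmx_nodal.
have := error_bound hL hT hr hgamma hstrip N0 Nt0 dS cfl hsmall1 hsmall2 parab
  exact_c (cf_cp corr_c) jW WM num init' bar nN iN.
move=> H; apply: le_trans H _.
have kL : i.+1%:R * hstep L N <= L.
  rewrite -[leRHS](xnode_size L N0) /xnode ler_pM2r// ler_nat.
  by apply: leq_trans (ltn_ord i) _; apply: ltnW; apply: ltnW; exact: sizeN.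
have M0 : 0 <= M := bound_ge0 hT hr hgamma hstrip WM.
rewrite -mulrA; apply: le_trans (ler_wpM2l _ (barPhi n i.+1 nN kL)) _.
  by apply: mulr_ge0 => //; apply: mulr_ge0 => //; lra.
rewrite /C (ger0_norm M0) -/h -/tau; lra.
Qed.
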